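(* Let $\psi:\mathbb{N}\to[0,\infty)$ be a function, and for each positive integer $h$ let $$S_h=\sum_{n=2^{2^h}+1}^{2^{2^{h+1}}}\frac{\psi(n)\varphi(n)}{n}.$$ If $$\sum_{h\ge1:\ S_h\ge3}\frac{\log S_h}{h\cdot\log\log S_h}=\infty,$$ then $\lambda(W(\psi))=1$.
   Context: $\mathbb{N}$ is the set of positive integers, $\varphi$ is the Euler phi function, and $\lambda$ is the Lebesgue measure on $\mathbb{R}/\mathbb{Z}$. For $n\in\mathbb{N}$, define the subset of $\mathbb{R}/\mathbb{Z}$ $$\mathcal{E}_n(\psi)=\bigcup_{1\le m\le n,\ (m,n)=1}\Big(\frac{m-\psi(n)}{n},\frac{m+\psi(n)}{n}\Big)$$ (intervals taken modulo $1$; $(m,n)$ under the union is the gcd), and $W(\psi)=\bigcap_{m=1}^{\infty}\bigcup_{n=m}^{\infty}\mathcal{E}_n(\psi)$. *)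

(* Defs.v *)
From HB Require Import structures.
From mathcomp Require Import all_boot all_order all_algebra.
From mathcomp Require Import generic_quotient.
From mathcomp Require Import all_classical all_reals all_analysis.
Import Order.TTheory GRing.Theory Num.Theory.
Import numFieldNormedType.Exports.

Set Implicit Arguments.
Unset Strict Implicit.
Unset Printing Implicit Defensive.

Local Open Scope classical_set_scope.
Local Open Scope ring_scope.
Local Open Scope quotient_scope.

Section CircleDef.
Variable R : realType.

Definition eqmodZ (x y : R) : bool := (x - y) \is a Num.int.

Lemma eqmodZ_refl : reflexive eqmodZ.
Proof. by move=> x; rewrite /eqmodZ subrr rpred0. Qed.

Lemma eqmodZ_sym : symmetric eqmodZ.
Proof. by move=> x y; rewrite /eqmodZ -opprB rpredN. Qed.

Lemma eqmodZ_trans : transitive eqmodZ.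
Proof.
by move=> y x z xy yz; rewrite /eqmodZ -(subrK y x) -addrA rpredD.
Qed.

Canonical eqmodZ_equiv := EquivRel eqmodZ eqmodZ_refl eqmodZ_sym eqmodZ_trans.

Definition circle := {eq_quot eqmodZ_equiv}.

Definition proj_circle (x : R) : circle := \pi_circle x.

(* Image under [proj_circle] of Lebesgue measure on the fundamental domain
   [0, 1). As [lebesgue_measure] is total, this is a function on all subsets;
   it is only meant for those whose preimage in R is measurable. *)
Definition circle_measure (A : set circle) : \bar R :=
  lebesgue_measure (`[0, 1[ `&` proj_circle @^-1` A).

End CircleDef.

Section LimsupSet.
Variables (R : realType) (psi : nat -> R).

Definition approx_set (n : nat) : set (circle R) :=
  \bigcup_(m in [set m | (1 <= m <= n)%N /\ coprime m n])
    (@proj_circle R @` `](m%:R - psi n) / n%:R, (m%:R + psi n) / n%:R[).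

Definition limsup_approx : set (circle R) :=
  \bigcap_(m in [set m | (1 <= m)%N])
    \bigcup_(n in [set n | (m <= n)%N]) approx_set n.

Definition block_sum (h : nat) : R :=
  \sum_((2 ^ (2 ^ h)).+1 <= n < (2 ^ (2 ^ h.+1)).+1)
    psi n * (totient n)%:R / n%:R.

End LimsupSet.

(* Main.v *)
(* Put delta n = eps_h 2^-(k_h) psi n / n for n in the h-th block of integers
   and let A_n be the union of the balls of radius delta n around the fractions
   a/n in lowest terms.  For m <> n, counting the pairs of fractions at distance less than
   delta m + delta n by the Chinese remainder theorem and a sieve, one gets
     mu (A_m `&` A_n) << (totient m)(totient n) (delta m)(delta n) (1 + ln T / (1 + ln Y)),
   where Y ~ m n max (delta m, delta n) / gcd (m, n) and m n <= 2^T, the left side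
   being 0 when Y < 1.  Averaged over the log S_h dyadic dilations 2^-k of psi,
   the last factor becomes 1 + h (log log S_h) / log S_h (this is where the divergent
   series enters), so some k_h is as good as the average.  For
   blocks four apart the factor is bounded, hence blocks decouple.  The weights
   g_h = (1 + h log log S_h / log S_h)^-1 have divergent sum, and the Abel-Dini
   theorem provides eps_h -> 0 with sum of eps_h g_h still divergent; weighting the
   blocks by eps_h g_h, a second moment argument yields a limsup set of positive measure.
   The set of points hit infinitely often up to some constant factor 2^j obeys a
   zero-one law: for each v the points hit by n of 2-adic valuation v form a set stable
   under x |-> 2 x + 2^-v; if all these sets are null, the whole set is, up to null
   sets, invariant under dyadic translations.  As eps_h -> 0, it is contained in W(psi). *)

(* The obstacle is the factor 1 + ln T / (1 + ln Y), which is of order ln T, hence of order h, when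
   Y is near 1. A dilation 2^-k replaces Y by 2^-k Y, so a given pair is bad for few k only: the sum
   of 1 / (1 + ln (2^-k Y)) over the k < K with 2^-k Y >= 1 is at most twice a harmonic sum, hence
   O(1 + ln K). Dilating is harmless as long as the block keeps mass at least 1, which leaves about
   log2 S_h values of k; this is the origin of log S_h / log log S_h, while h comes from ln T with T
   = 2^(h+2). The lower bound on the mass also controls the pairs m = n, whose contribution is
   linear and not quadratic in the mass. Between two blocks Y has to be large, which asks for lower
   bounds on the radii: values psi n < n^-2 are dropped, 2^-k is bounded below by means of psi n <
   n, and the Abel-Dini factor is at least 1 / (h + 2). If psi n >= n infinitely often, every point
   is covered directly. *)
Require Import Defs.
From mathcomp Require Import all_boot all_order all_algebra.
From mathcomp Require Import generic_quotient zify ring lra.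
From mathcomp Require Import all_classical all_reals all_analysis.
From mathcomp Require Import measurable_realfun.
Import Order.TTheory GRing.Theory Num.Theory.
Import numFieldNormedType.Exports.

Set Implicit Arguments.
Unset Strict Implicit.
Unset Printing Implicit Defensive.

Local Open Scope classical_set_scope.
Local Open Scope ring_scope.

(** * A sieve bound for coprimality sums *)

Section NumberTheory.
Context {R : realType}.
Implicit Types (n m p q d k N X Y : nat).

Lemma sum_multiples (F : nat -> R) X d : (0 < d)%N ->
  \sum_(1 <= n < X.+1 | (d %| n)%N) F n =
  \sum_(1 <= m < X.+1 | (d * m <= X)%N) F (d * m)%N.
Proof.
move=> d0; rewrite [RHS]big_mkcond [LHS]big_mkcond /=.
transitivity (\sum_(1 <= n < X.+1) \sum_(1 <= m < X.+1)
    (if n == (d * m)%N then F n else 0)).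
  apply: eq_big_nat => n /andP[n1 nX]; case: ifP => dn.
    rewrite -big_mkcond /= (eq_bigl (fun m => m == (n %/ d)%N)); last first.
      by move=> m; apply/eqP/eqP => ->; rewrite ?mulKn// mulnC divnK.
    rewrite big_nat1_eq ifT// divn_gt0// dvdn_leq//=.
    by rewrite ltnS (leq_trans (leq_div _ _)).
  rewrite big1// => m _; case: eqP => // e.
  by rewrite e dvdn_mulr in dn.
rewrite exchange_big_nat /=; apply: eq_big_nat => m /andP[m1 mX].
by rewrite -big_mkcond /= big_nat1_eq muln_gt0 d0 m1 ltnS.
Qed.

Definition vonMangoldt n : R := if primes n is [:: p] then ln p%:R else 0.

Lemma ln_nat_ge0 n : 0 <= ln n%:R :> R.
Proof. by case: n => [|n]; [rewrite ln0|rewrite ln_ge0// ler1n]. Qed.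

Lemma vonMangoldt_ge0 n : 0 <= vonMangoldt n.
Proof.
by rewrite /vonMangoldt; case: (primes n) => [//|p [|//]]; exact: ln_nat_ge0.
Qed.

Lemma primes_seq1 n p : primes n = [:: p] ->
  [/\ prime p, n = (p ^ logn p n)%N & (0 < logn p n)%N].
Proof.
move=> e; have pn : p \in primes n by rewrite e mem_head.
have n0 : (0 < n)%N by case: n pn {e}.
split; last by rewrite logn_gt0.
  by move: pn; rewrite mem_primes => /andP[].
by rewrite [LHS]prod_prime_decomp// prime_decompE e big_seq1.
Qed.

Lemma vonMangoldtX p k : prime p -> (0 < k)%N -> vonMangoldt (p ^ k) = ln p%:R.
Proof. by move=> pp k0; rewrite /vonMangoldt primesX// primes_prime. Qed.

(** Multiplying by [p] creates exactly one new prime power divisor, the next power of [p]. This is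
    the induction step of [sum_vonMangoldt]. *)
Lemma vonMangoldt_mul p n d : prime p -> (0 < n)%N ->
  (d %| p * n)%N%:R * vonMangoldt d = (d %| n)%N%:R * vonMangoldt d +
     (d == p ^ (logn p n).+1)%N%:R * ln p%:R.
Proof.
move=> pp n0; have [->|dp] := eqVneq d (p ^ (logn p n).+1)%N.
  rewrite vonMangoldtX// !pfactor_dvdn ?muln_gt0 ?(prime_gt0 pp)//.
  by rewrite lognM ?(prime_gt0 pp)// (logn_prime p pp) eqxx add1n ltnn leqnn mul0r add0r.
rewrite mul0r addr0 /vonMangoldt.
case e: (primes d) => [|r [|//]]; rewrite ?mulr0//.
have [pr dr k0] := primes_seq1 e; congr (_%:R * _); congr (nat_of_bool _).
have [rp|rp] := eqVneq r p.
  subst r; rewrite dr !pfactor_dvdn ?muln_gt0 ?(prime_gt0 pp)// lognM ?(prime_gt0 pp)//.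
  rewrite (logn_prime p pp) eqxx add1n leq_eqVlt -[in RHS]ltnS; case: eqP => // e1.
  by rewrite dr e1 eqxx in dp.
rewrite dr Gauss_dvdr// coprimeXl// prime_coprime// dvdn_prime2//.
Qed.

Lemma sum_vonMangoldt n N : (0 < n <= N)%N ->
  \sum_(1 <= d < N.+1 | (d %| n)%N) vonMangoldt d = ln n%:R.
Proof.
rewrite big_mkcond/= => /andP[]; elim/ltn_ind: n => n IH n0 nN.
have [n1|n1] := ltnP 1 n; last first.
  have -> : n = 1%N by apply/eqP; rewrite eqn_leq n1.
  rewrite ln1 big1// => d _; rewrite dvdn1; case: eqP => // ->.
  by rewrite /vonMangoldt.
have [p pp pn] : exists2 p, prime p & (p %| n)%N.
  by exists (pdiv n); [exact: pdiv_prime|exact: pdiv_dvd].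
have e : n = (p * (n %/ p))%N by rewrite mulnC divnK.
have m0 : (0 < n %/ p)%N by rewrite divn_gt0 ?(prime_gt0 pp)// dvdn_leq.
have mn : (n %/ p < n)%N by rewrite ltn_Pdiv// prime_gt1.
have -> : ln n%:R = ln p%:R + ln (n %/ p)%:R :> R.
  by rewrite [in LHS]e natrM lnM ?posrE ?ltr0n ?(prime_gt0 pp).
rewrite -(IH _ mn m0 (leq_trans (ltnW mn) nN)).
rewrite (eq_bigr (fun d => (if (d %| n %/ p)%N then vonMangoldt d else 0) +
    (if d == (p ^ (logn p (n %/ p)).+1)%N then ln p%:R else 0))); last first.
  move=> d _; have := vonMangoldt_mul d pp m0; rewrite -e.
  by do 3!case: ifP => _; rewrite ?mul1r ?mul0r.
rewrite big_split/= -[X in _ + X]big_mkcond/= big_nat1_eq addrC ifT//.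
rewrite expn_gt0 prime_gt0//= ltnS (leq_trans _ nN)// dvdn_leq//.
suff en : logn p n = (logn p (n %/ p)).+1 by rewrite pfactor_dvdn// en.
by rewrite [in LHS]e lognM ?(prime_gt0 pp)// (logn_prime p pp) eqxx.
Qed.

(** Summation of [sum_vonMangoldt] over the factors of the factorial. The range [M] is free so that
    ln n! and ln (2n)! can be compared term by term. *)
Lemma ln_fact N M : (N <= M)%N ->
  ln (N`!)%:R = \sum_(1 <= d < M.+1) vonMangoldt d * (N %/ d)%:R.
Proof.
elim: N => [|N IH] NM.
  by rewrite ln1 big1// => d _; rewrite div0n mulr0.
rewrite factS natrM lnM ?posrE ?ltr0n ?fact_gt0// IH; last exact: ltnW.
rewrite -(@sum_vonMangoldt N.+1 M)// big_mkcond -big_split/=.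
apply: eq_big_nat => d /andP[d0 _]; rewrite divnS// natrD mulrDr.
by case: ifP => _; rewrite ?mulr1 ?mulr0.
Qed.

Definition chebyshev_psi N : R := \sum_(1 <= d < N.+1) vonMangoldt d.

Lemma ler_chebyshev_psi N M : (N <= M)%N -> chebyshev_psi N <= chebyshev_psi M.
Proof.
move=> NM; rewrite /chebyshev_psi [leRHS](big_cat_nat (n := N.+1))//= lerDl.
by rewrite sumr_ge0// => *; exact: vonMangoldt_ge0.
Qed.

Lemma ln_natX2 n : ln (2 ^ n)%:R = ln 2 *+ n :> R.
Proof. by rewrite natrX lnXn. Qed.

Lemma ln2_le1 : ln 2 <= 1 :> R.
Proof. by have := @le_ln1Dx R 1 ltac:(lra); rewrite (_ : 1 + 1 = 2)//; lra. Qed.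

(** Chebyshev's argument: in ln C(2n, n) the coefficient of [vonMangoldt d] is floor(2n/d) - 2
    floor(n/d), which is nonnegative, and equal to 1 for n < d <= 2n; on the other hand C(2n, n) <=
    4^n and ln 2 <= 1. *)
Lemma chebyshev_psi_double n :
  chebyshev_psi n.*2 <= chebyshev_psi n + (n.*2)%:R.
Proof.
have : ln ('C(n.*2, n))%:R <= (n.*2)%:R :> R.
  have h : ('C(n.*2, n) <= 2 ^ n.*2)%N.
    rewrite -[2%N]/(1 + 1)%N expnDn.
    have nn : (n < n.*2.+1)%N by rewrite ltnS -addnn leq_addr.
    by rewrite (bigD1 (Ordinal nn))//= !exp1n !muln1 leq_addr.
  apply: (@le_trans _ _ (ln (2 ^ n.*2)%:R)).
    by rewrite ler_ln ?posrE ?ltr0n ?expn_gt0// ?ler_nat// bin_gt0 -addnn leq_addr.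
  rewrite ln_natX2 -[leLHS]mulr_natr; have := ln2_le1; have : 0 <= (n.*2)%:R :> R by [].
  nra.
have fE : ('C(n.*2, n) * (n`! * n`!))%N = (n.*2)`!.
  by have := @bin_fact n.*2 n; rewrite -addnn addnK => -> //; rewrite leq_addr.
have lE : ln ('C(n.*2, n))%:R + (ln n`!%:R + ln n`!%:R) = ln (n.*2)`!%:R :> R.
  rewrite -fE !natrM !lnM ?posrE ?mulr_gt0 ?ltr0n ?fact_gt0//.
  by rewrite bin_gt0 -addnn leq_addr.
rewrite (@ln_fact n n.*2) ?(@ln_fact n.*2 n.*2)// in lE; last by rewrite -addnn leq_addr.
move=> hC; rewrite addrC -lerBlDr.
suff : chebyshev_psi n.*2 - chebyshev_psi n <= ln ('C(n.*2, n))%:R by lra.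
rewrite lerBlDr -(@addrK _ (\sum_(1 <= d < (n.*2).+1) vonMangoldt d * (n %/ d)%:R +
  \sum_(1 <= d < (n.*2).+1) vonMangoldt d * (n %/ d)%:R) (ln ('C(n.*2, n))%:R)) lE.
rewrite opprD addrA -!sumrB -lerBlDr.
rewrite /chebyshev_psi (big_cat_nat (n := n.+1))//=; last by rewrite ltnS -addnn leq_addr.
rewrite addrAC subrr add0r.
rewrite [leRHS](big_cat_nat (n := n.+1))//=; last by rewrite ltnS -addnn leq_addr.
rewrite -[leLHS]add0r lerD//.
  apply: sumr_ge0 => d _; rewrite -!mulrBr mulr_ge0 ?vonMangoldt_ge0//.
  rewrite -addrA -opprD subr_ge0 -natrD ler_nat addnn.
  have [->|d0] := posnP d; first by rewrite !divn0.
  by rewrite leq_divRL// -muln2 mulnAC muln2 leq_double leq_trunc_div.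
apply: ler_sum_nat => d /andP[nd dn].
rewrite [in leRHS](_ : n %/ d = 0)%N; last by rewrite divn_small.
rewrite mulr0 !subr0 -[leLHS]mulr1 ler_wpM2l ?vonMangoldt_ge0// ler1n.
by rewrite divn_gt0// (leq_ltn_trans _ nd).
Qed.

(** Iterated doubling gives the bound 2^(k+1) at 2^k; rounding [N] up to a power of 2 costs another
    factor 2. *)
Lemma chebyshev_psi_le N : chebyshev_psi N <= 4 * N%:R.
Proof.
have h k : chebyshev_psi (2 ^ k) <= (2 ^ k.+1)%:R.
  elim: k => [|k IH].
    by rewrite /chebyshev_psi big_nat1 /vonMangoldt.
  rewrite expnS mul2n (le_trans (chebyshev_psi_double _))//.
  rewrite -mul2n -expnS [in leRHS]expnS natrM; lra.
have [->|N0] := posnP N.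
  by rewrite /chebyshev_psi big_geq// mulr0.
have /andP[h1 h2] := trunc_log_bounds (isT : (1 < 2)%N) N0.
rewrite (le_trans (ler_chebyshev_psi (ltnW h2)))// (le_trans (h _))//.
rewrite !expnS !natrM mulrA; have : (2 ^ trunc_log 2 N)%:R <= N%:R :> R by rewrite ler_nat.
lra.
Qed.

(** Mertens: N/p <= floor(N/p) + 1, so N times the sum is at most ln N! plus the Chebyshev function
    at [N]. *)
Lemma sum_ln_prime N : (0 < N)%N ->
  \sum_(1 <= p < N.+1 | prime p) ln p%:R / p%:R <= ln N%:R + 4 :> R.
Proof.
move=> N0; have N0' : 0 < N%:R :> R by rewrite ltr0n.
have hf : ln N`!%:R <= ln N%:R * N%:R :> R.
  rewrite mulr_natr -lnXn// ler_ln ?posrE ?ltr0n ?fact_gt0 ?exprn_gt0//.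
  rewrite -natrX ler_nat; elim: N {N0 N0'} => // n IH.
  rewrite factS expnS leq_mul2l (leq_trans IH) ?orbT//.
  by case: n {IH} => // n; rewrite leq_exp2r.
rewrite -(ler_pM2r N0') mulrDl.
apply: (@le_trans _ _ (ln N`!%:R + chebyshev_psi N)); last first.
  by rewrite lerD// chebyshev_psi_le.
rewrite (@ln_fact N N)// /chebyshev_psi -big_split/= mulr_suml.
rewrite big_mkcond/=; apply: ler_sum_nat => p /andP[p0 _].
have hp : 0 < p%:R :> R by rewrite ltr0n.
case: ifP => pp; last by rewrite addr_ge0// ?mulr_ge0// vonMangoldt_ge0.
have -> : vonMangoldt p = ln p%:R by rewrite -(@vonMangoldtX p 1)// expn1.
rewrite -mulrA -[X in _ + X]mulr1 -mulrDr ler_wpM2l ?ln_nat_ge0//.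
rewrite mulrC ler_pdivrMr//.
have : (N <= (N %/ p + 1) * p)%N by rewrite addn1 ltnW// ltn_ceil.
by rewrite -(ler_nat R) natrM natrD.
Qed.

Definition mertens_const : R := 1 - ln (ln 2) + 4 / ln 2.

Lemma ln2_gt0 : 0 < ln 2 :> R. Proof. by rewrite ln_gt0// ltr1n. Qed.

(** Partial summation from [sum_ln_prime], carried out as an induction on [N] in [h]. With a = ln n
    and b = ln (n+1) the increment is at most (a + 4)(1/a - 1/b), and 1 - a/b <= ln b - ln a makes
    it telescope. *)
Lemma sum_inv_prime N : (1 < N)%N ->
  \sum_(1 <= p < N.+1 | prime p) p%:R^-1 <= ln (ln N%:R) + mertens_const.
Proof.
move=> N1.
pose A n : R := \sum_(1 <= p < n.+1 | prime p) ln p%:R / p%:R.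
have lnN n : (1 < n)%N -> 0 < ln n%:R :> R by move=> n1; rewrite ln_gt0// ltr1n.
have h : \sum_(1 <= p < N.+1 | prime p) p%:R^-1 <= A N / ln N%:R +
    (ln (ln N%:R) - ln (ln 2) + 4 / ln 2 - 4 / ln N%:R).
  case: N N1 => [//|[//|N]] _; elim: N => [|N IH].
    rewrite subrr add0r subrr addr0 /A /index_iota /= !big_cons !big_nil /= !addr0.
    by rewrite mulrAC mulfV ?mul1r// gt_eqF// ln2_gt0.
  rewrite big_mkcond big_nat_recr//= -big_mkcond/=.
  rewrite (le_trans (lerD IH (lexx _)))//.
  have -> : A N.+3 = A N.+2 + (if prime N.+3 then ln N.+3%:R / N.+3%:R else 0).
    by rewrite /A big_mkcond big_nat_recr//= -big_mkcond.
  have hA : A N.+2 <= ln N.+2%:R + 4 by exact: sum_ln_prime.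
  have l2 := lnN N.+2 isT; have l3 := lnN N.+3 isT.
  set a := ln N.+2%:R in hA l2 *; set b := ln N.+3%:R in l3 *.
  have ab : a <= b by rewrite ler_ln ?posrE ?ltr0n// ler_nat.
  have hl : 1 - a / b <= ln b - ln a.
    have := @le_ln1Dx R (a / b - 1); rewrite (_ : 1 + (a / b - 1) = a / b); last by ring.
    rewrite ln_div ?posrE// ltrBrDr addNr divr_gt0// => /(_ isT); lra.
  have hab : (a + 4) * (a^-1 - b^-1) = 1 - a / b + 4 / a - 4 / b.
    by field; rewrite !gt_eqF.
  have hi : 0 <= a^-1 - b^-1 by rewrite subr_ge0 lef_pV2 ?posrE.
  have hAa : A N.+2 * (a^-1 - b^-1) <= 1 - a / b + 4 / a - 4 / b.
    by rewrite -hab ler_wpM2r.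
  have hp : (if prime N.+3 then N.+3%:R^-1 else 0) = (if prime N.+3 then b / N.+3%:R else 0) / b.
    by case: ifP => _; rewrite ?mul0r// mulrAC mulfV ?mul1r// gt_eqF.
  rewrite hp mulrDl; move: hAa; rewrite mulrBr; lra.
rewrite (le_trans h)// /mertens_const.
have : A N / ln N%:R <= 1 + 4 / ln N%:R.
  rewrite -[X in X + _](@mulfV _ (ln N%:R)) ?gt_eqF ?lnN// -mulrDl.
  by rewrite ler_pM2r ?invr_gt0 ?lnN// sum_ln_prime// ltnW.
lra.
Qed.

(** The factor at [p] is the sum over k >= 0 of p^-k times p/(p-1) for k > 0 and 1 for k = 0, that
    is, the local factor of the sum of [sieve_wt] n / n. It exceeds 1 + 1/p by at most 3 / (p
    (p-1)), whose sum telescopes. *)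
Lemma mertens_prod : exists2 C : R, 0 < C & forall N, (1 < N)%N ->
  \prod_(1 <= p < N.+1 | prime p) (1 + p%:R / (p%:R - 1) ^+ 2) <= C * ln N%:R.
Proof.
exists (expR (mertens_const + 3)); first exact: expR_gt0.
move=> N N1; have lnN : 0 < ln N%:R :> R by rewrite ln_gt0// ltr1n.
have tel : \sum_(1 <= p < N.+1 | prime p) 3 / (p%:R * (p%:R - 1)) <= 3 :> R.
  rewrite -mulr_sumr ger_pMr// big_mkcond big_ltn ?ltnS ?(ltnW N1)//= add0r.
  suff h M : \sum_(2 <= p < M.+2) (if prime p then (p%:R * (p%:R - 1))^-1 else 0) <=
      1 - M.+1%:R^-1 :> R.
    by case: N N1 {lnN} => [//|N] _; rewrite (le_trans (h N))// gerBl invr_ge0.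
  elim: M => [|M IH]; first by rewrite big_geq// invr1 subrr.
  rewrite big_nat_recr//= (le_trans (lerD IH (lexx _)))//.
  have h1 : M.+2%:R = M.+1%:R + 1 :> R by rewrite -natr1.
  have h0 : 0 < M.+1%:R :> R by rewrite ltr0n.
  case: ifP => _.
    by rewrite le_eqVlt; apply/orP; left; apply/eqP; rewrite h1; field; rewrite !gt_eqF//; lra.
  rewrite addr0 lerD2l lerN2 lef_pV2 ?posrE//; lra.
apply: (@le_trans _ _ (expR (\sum_(1 <= p < N.+1 | prime p)
    (p%:R^-1 + 3 / (p%:R * (p%:R - 1)))))).
  rewrite expR_sum; apply: ler_prod => p pp.
  have p2 : 2 <= p%:R :> R by rewrite ler_nat prime_gt1.
  rewrite addr_ge0 ?divr_ge0 ?exprn_ge0//=; last lra.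
  rewrite (le_trans _ (expR_ge1Dx _))// lerD2l.
  have -> : p%:R / (p%:R - 1) ^+ 2 =
      p%:R^-1 + (2 * p%:R - 1) / (p%:R - 1) / (p%:R * (p%:R - 1)) :> R.
    by field; rewrite !gt_eqF; lra.
  rewrite lerD2l ler_pM2r ?invr_gt0; last by apply: mulr_gt0; lra.
  rewrite ler_pdivrMr; lra.
rewrite big_split/= -[X in _ <= _ * X](lnK lnN) -expRD ler_expR.
have := sum_inv_prime N1; lra.
Qed.

(* [n / totient n] on the integers coprime to [q]. *)
Definition sieve_wt q n : R :=
  (coprime n q)%:R * \prod_(p <- primes n) (1 + (p%:R - 1)^-1).

Lemma prime_wt_ge1 p : 1 <= 1 + (p.+1%:R - 1)^-1 :> R.
Proof. by rewrite lerDl invr_ge0 -natr1 addrK. Qed.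

Lemma prod_primes_ge1 n : 1 <= \prod_(p <- primes n) (1 + (p%:R - 1)^-1) :> R.
Proof.
rewrite big_seq; elim/big_ind: _ => // [x y x1 y1|p].
  by rewrite (le_trans x1)// ler_peMr// (le_trans _ x1).
by rewrite mem_primes => /andP[/prime_gt0]; case: p => [//|p] _ _; exact: prime_wt_ge1.
Qed.

Lemma sieve_wt_ge0 q n : 0 <= sieve_wt q n.
Proof. by rewrite mulr_ge0// (le_trans _ (prod_primes_ge1 n)). Qed.

Lemma sieve_wt_mul q p m : prime p -> (0 < m)%N -> sieve_wt q (p * m) =
  if (p %| q)%N then 0 else
  if (p %| m)%N then sieve_wt q m else (1 + (p%:R - 1)^-1) * sieve_wt q m.
Proof.
move=> pp m0; rewrite /sieve_wt coprimeMl (prime_coprime _ pp).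
case: ifP => pq; first by rewrite mul0r.
rewrite /=; have pE x : (x \in primes (p * m)) = (x == p) || (x \in primes m).
  by rewrite primesM ?(prime_gt0 pp)// primes_prime// inE.
case: ifP => pm.
  congr (_ * _); apply: perm_big; apply: uniq_perm; rewrite ?primes_uniq// => x.
  by rewrite pE; case: eqP => // ->; rewrite mem_primes pp m0 pm.
rewrite mulrCA; congr (_ * _); rewrite -(big_cons _ _ p _ xpredT (fun p => 1 + (p%:R - 1)^-1)).
apply: perm_big; apply: uniq_perm; rewrite ?primes_uniq//=.
by rewrite primes_uniq andbT mem_primes pp m0 pm.
Qed.

(** The weight depends only on the set of primes, and one new prime costs 1 + 1/(p-1) <= 2, whatever
    its exponent. *)
Lemma sieve_wt_mulX q p k m : prime p -> (0 < m)%N ->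
  sieve_wt q (p ^ k * m) <= 2 * sieve_wt q m.
Proof.
move=> pp m0; have w0 := sieve_wt_ge0 q m; elim: k => [|k IH].
  by rewrite mul1n ler_peMl// ler1n.
rewrite expnS -mulnA sieve_wt_mul// ?muln_gt0 ?expn_gt0 ?(prime_gt0 pp)//.
case: ifP => _; first by rewrite mulr_ge0.
case: ifP => pk //; case: k IH pk => [|k] IH; last by rewrite expnS -mulnA dvdn_mulr.
rewrite mul1n => _; rewrite ler_wpM2r// lerD2l invf_le1.
  by rewrite lerBrDr (_ : 1 + 1 = 2%:R :> R)// ler_nat prime_gt1.
by rewrite subr_gt0 ltr1n prime_gt1.
Qed.

(* Since [ln n] is the sum of [vonMangoldt d] over [d %| n], the sum of
   [sieve_wt q n * ln n] is controlled by Chebyshev's bound applied at [X / m]. *)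
Lemma halberstam_richert q X : (0 < X)%N ->
  (1 + ln X%:R) * \sum_(1 <= n < X.+1) sieve_wt q n <=
  10 * X%:R * \sum_(1 <= n < X.+1) sieve_wt q n / n%:R.
Proof.
move=> X0; have X0' : 0 < X%:R :> R by rewrite ltr0n.
set L := \sum_(1 <= n < X.+1) sieve_wt q n / n%:R.
have hG : \sum_(1 <= n < X.+1) sieve_wt q n <= X%:R * L.
  rewrite mulr_sumr; apply: ler_sum_nat => n /andP[n1 nX].
  rewrite mulrCA ler_peMr ?sieve_wt_ge0// ler_pdivlMr ?ltr0n// mul1r ler_nat//.
have hlog : \sum_(1 <= n < X.+1) sieve_wt q n * ln n%:R <= 8 * X%:R * L.
  rewrite (eq_big_nat _ _ (F2 := fun n => \sum_(1 <= d < X.+1 | (d %| n)%N)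
      sieve_wt q n * vonMangoldt d)); last first.
    by move=> n /andP[n1 nX]; rewrite -mulr_sumr (@sum_vonMangoldt n X)// n1.
  rewrite (eq_bigr (fun n => \sum_(1 <= d < X.+1)
     (if (d %| n)%N then sieve_wt q n * vonMangoldt d else 0))); last first.
    by move=> n _; rewrite big_mkcond.
  rewrite exchange_big_nat/=.
  apply: (@le_trans _ _ (\sum_(1 <= d < X.+1) \sum_(1 <= m < X.+1)
      (if (d * m <= X)%N then 2 * sieve_wt q m * vonMangoldt d else 0))).
    apply: ler_sum_nat => d /andP[d1 dX].
    rewrite -big_mkcond sum_multiples// big_mkcond/=.
    apply: ler_sum_nat => m /andP[m1 mX]; case: ifP => // _.
    rewrite /vonMangoldt; case e: (primes d) => [|p [|//]]; rewrite ?mulr0//.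
    have [pp -> _] := primes_seq1 e.
    by rewrite ler_wpM2r ?ln_nat_ge0// sieve_wt_mulX.
  rewrite exchange_big_nat/= mulr_sumr; apply: ler_sum_nat => m /andP[m1 mX].
  rewrite -big_mkcond/= -mulr_sumr.
  have -> : \sum_(1 <= d < X.+1 | (d * m <= X)%N) vonMangoldt d = chebyshev_psi (X %/ m).
    rewrite /chebyshev_psi [RHS](@big_nat_widen _ _ _ _ _ X.+1) ?ltnS ?leq_div//.
    by apply: eq_bigl => d; rewrite ltnS leq_divRL.
  have -> : 8 * X%:R * (sieve_wt q m / m%:R) = 2 * sieve_wt q m * (4 * (X%:R / m%:R)) by ring.
  apply: ler_wpM2l; first by rewrite mulr_ge0 ?sieve_wt_ge0.
  apply: (le_trans (chebyshev_psi_le _)); apply: ler_wpM2l => //.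
  by rewrite ler_pdivlMr ?ltr0n// -natrM ler_nat leq_trunc_div.
(* Replacing ln n by ln X costs ln (X/n) <= X/n, so one more X L. The constant 10 is 8 from [hlog],
   1 from here and 1 from [hG]. *)
have hX : ln X%:R * \sum_(1 <= n < X.+1) sieve_wt q n <=
    \sum_(1 <= n < X.+1) sieve_wt q n * ln n%:R + X%:R * L.
  rewrite !mulr_sumr -big_split/=; apply: ler_sum_nat => n /andP[n1 nX].
  have n0 : 0 < n%:R :> R by rewrite ltr0n.
  have -> : X%:R * (sieve_wt q n / n%:R) = sieve_wt q n * (X%:R / n%:R) by ring.
  rewrite -mulrDr mulrC ler_wpM2l ?sieve_wt_ge0//.
  have := @ln_sublinear R (X%:R / n%:R); rewrite divr_gt0// ln_div ?posrE// => /(_ isT); lra.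
rewrite mulrDl mul1r; lra.
Qed.

Let smooth Y n := all (fun p => (p <= Y)%N) (primes n).

(** Induction on [Y]. If p = Y + 1 is prime and does not divide [q], let B and A be the parts of the
    sum over multiples and non-multiples of p. Writing n = p m and separating p | m from the rest
    gives B <= B/p + A/(p-1), hence B <= A p/(p-1)^2. If p divides [q], the multiples have weight
    0. *)
Lemma smooth_sum_le q X Y :
  \sum_(1 <= n < X.+1 | smooth Y n) sieve_wt q n / n%:R <=
  \prod_(1 <= p < Y.+1 | prime p && ~~ (p %| q)%N) (1 + p%:R / (p%:R - 1) ^+ 2).
Proof.
have wn0 n : 0 <= sieve_wt q n / n%:R by rewrite divr_ge0// sieve_wt_ge0.
elim: Y => [|Y IH].
  rewrite big_geq//.
  have -> : \sum_(1 <= n < X.+1 | smooth 0 n) sieve_wt q n / n%:R =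
      \sum_(1 <= n < X.+1 | n == 1%N) sieve_wt q n / n%:R.
    rewrite big_nat_cond [RHS]big_nat_cond; apply: eq_bigl => n; apply: andb_id2l.
    move=> /andP[n1 _]; apply/allP/eqP => [h|->//].
    apply/eqP; rewrite eqn_leq n1 andbT leqNgt; apply/negP => n2.
    have := h _ (_ : pdiv n \in primes n); rewrite mem_primes pdiv_prime// pdiv_dvd n1.
    by move=> /(_ isT); rewrite leqNgt pdiv_gt0.
  rewrite big_nat1_eq; case: ifP => // _.
  by rewrite /sieve_wt big_nil coprime1n divr1 mulr1.
have [pp|np] := boolP (prime Y.+1); last first.
  rewrite [leRHS]big_mkcond big_nat_recr//= (negbTE np)/= mulr1 -big_mkcond/=.
  rewrite (eq_bigl (smooth Y))// => n; apply: eq_in_all => r.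
  rewrite mem_primes (leq_eqVlt r) ltnS => /andP[pr _].
  by case: eqP => // e; rewrite -e pr in np.
set p := Y.+1 in pp *.
rewrite (bigID (fun n => (p %| n)%N))/=.
set B := \sum_(_ <= _ < _ | _ && (p %| _)%N) _; set A := \sum_(_ <= _ < _ | _) _.
have p2 : 2 <= p%:R :> R by rewrite ler_nat prime_gt1.
have hA : A <= \prod_(1 <= r < Y.+1 | prime r && ~~ (r %| q)%N) (1 + r%:R / (r%:R - 1) ^+ 2).
  apply: le_trans IH; rewrite /A [leLHS]big_mkcond [leRHS]big_mkcond/=.
  apply: ler_sum_nat => n /andP[n1 _]; case: ifP => [/andP[/allP sn pn]|_]; last by case: ifP.
  rewrite ifT//; apply/allP => r rn; have := sn r rn; rewrite leq_eqVlt ltnS => /predU1P[e|//].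
  by move: rn pn; rewrite mem_primes e => /and3P[_ _ ->].
have A0 : 0 <= A by exact: sumr_ge0.
have hB : B <= if (p %| q)%N then 0 else B / p%:R + A / (p%:R - 1).
  rewrite {1}/B; under eq_bigl do rewrite andbC.
  rewrite big_mkcondr/= sum_multiples ?prime_gt0//.
  case: ifP => pq.
    rewrite big1_seq// => m /andP[_]; rewrite mem_index_iota => /andP[m0 _].
    by rewrite sieve_wt_mul// pq mul0r; case: ifP.
  rewrite big_mkcond/= /B /A !mulr_suml [X in _ <= X + _]big_mkcond [X in _ <= _ + X]big_mkcond.
  rewrite -big_split/=; apply: ler_sum_nat => m /andP[m0 _].
  have sp : smooth p (p * m) = smooth p m.
    apply/allP/allP => h r rm; first by apply: h; rewrite primesM ?(prime_gt0 pp)// rm orbT.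
    by move: rm; rewrite primesM ?(prime_gt0 pp)// primes_prime// inE => /predU1P[->//|]; exact: h.
  have [_|_] := leqP (p * m) X; last first.
    by rewrite addr_ge0//; case: ifP => _ //; rewrite divr_ge0//; lra.
  rewrite sp; case: (smooth p m) => /=; last by rewrite addr0.
  rewrite sieve_wt_mul// pq; case: ifP => pm /=.
    by rewrite addr0 natrM invfM mulrA mulrAC.
  rewrite add0r le_eqVlt; apply/orP; left; apply/eqP; rewrite natrM; field.
  rewrite pnatr_eq0 -lt0n m0 !gt_eqF//; lra.
have hB' : B <= if (p %| q)%N then 0 else A * (p%:R / (p%:R - 1) ^+ 2).
  move: hB; case: ifP => // _ hB.
  have -> : A * (p%:R / (p%:R - 1) ^+ 2) = A / (p%:R - 1) / ((p%:R - 1) / p%:R).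
    by field; rewrite !gt_eqF//; lra.
  rewrite ler_pdivlMr; last by rewrite divr_gt0//; lra.
  have -> : B * ((p%:R - 1) / p%:R) = B - B / p%:R by field; rewrite gt_eqF//; lra.
  lra.
rewrite [leRHS]big_mkcond big_nat_recr//= -big_mkcond/= -/p pp/=.
have f0 : 0 <= p%:R / (p%:R - 1) ^+ 2 :> R by rewrite divr_ge0 ?exprn_ge0; lra.
move: hB'; case: ifP => /= _ hB'; first by rewrite mulr1; lra.
apply: (@le_trans _ _ (A * (1 + p%:R / (p%:R - 1) ^+ 2))); first by lra.
by rewrite ler_wpM2r//; lra.
Qed.

Lemma size_primes q T : (0 < q <= 2 ^ T)%N -> (size (primes q) <= T)%N.
Proof.
move=> /andP[q0 qT]; rewrite -(@leq_exp2l 2)//; apply: leq_trans qT.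
rewrite [leqRHS]prod_prime_decomp// prime_decompE big_map/= -(count_predT (primes q)).
rewrite -iter_muln_1 -big_const_seq.
rewrite big_seq [leqRHS]big_seq; apply: leq_prod => p pq.
have pp : prime p by move: pq; rewrite mem_primes => /andP[].
by rewrite (leq_trans (prime_gt1 pp))// -[leqLHS]expn1 leq_exp2l ?prime_gt1// logn_gt0.
Qed.

(** By [halberstam_richert] it suffices to bound L Q. The Euler product bounding L lacks the primes
    of [q]; those up to Y are supplied by Q, and together they form the full Mertens product. *)
Lemma sieve_bound : exists2 C : R, 0 < C & forall q T X,
  (0 < q <= 2 ^ T)%N -> (1 < T)%N -> (0 < X)%N ->
  (\sum_(1 <= n < X.+1) sieve_wt q n) * \prod_(p <- primes q) (1 + (p%:R - 1)^-1)
    <= C * X%:R * (1 + ln T%:R / (1 + ln X%:R)).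
Proof.
have [C C0 hC] := mertens_prod.
exists (10 * C * expR 1); first by rewrite !mulr_gt0 ?expR_gt0.
move=> q T X qT T1 X0; have sT := size_primes qT; have /andP[q0 _] := qT.
set G := \sum_(_ <= _ < _) _; set Q := \prod_(_ <- _) _.
set L := \sum_(1 <= n < X.+1) sieve_wt q n / n%:R.
have lX : 0 <= ln X%:R :> R by exact: ln_nat_ge0.
have lT : 0 <= ln T%:R :> R by exact: ln_nat_ge0.
have lX1 : 0 < 1 + ln X%:R :> R by lra.
(* ln Y <= ln X + ln T is the source of ln T in the bound. Primes of [q] above Y are at most T in
   number and have factors at most 1 + 1/T, so their product is at most e. *)
pose Y := maxn X T.
have Y1 : (1 < Y)%N by rewrite (leq_trans T1)// leq_maxr.
have hL : L <= \prod_(1 <= p < Y.+1 | prime p && ~~ (p %| q)%N) (1 + p%:R / (p%:R - 1) ^+ 2).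
  apply: le_trans (smooth_sum_le q X Y).
  rewrite le_eqVlt; apply/orP; left; apply/eqP; rewrite /L big_nat_cond [RHS]big_nat_cond.
  apply: eq_bigl => n; rewrite andbT; case/boolP: (_ <= _ < _)%N => //= /andP[n1 nX].
  apply/esym/allP => r; rewrite mem_primes => /and3P[_ _ /dvdn_leq rn].
  by rewrite (leq_trans (rn n1))// (leq_trans _ (leq_maxl _ _)).
have hQ : Q <= \prod_(1 <= p < Y.+1 | prime p && (p %| q)%N) (1 + p%:R / (p%:R - 1) ^+ 2) * expR 1.
  rewrite /Q (bigID (fun p => (p <= Y)%N))/=.
  have pos (P : pred nat) : 0 <= \prod_(p <- primes q | P p) (1 + (p%:R - 1)^-1) :> R.
    rewrite big_seq_cond; apply: prodr_ge0 => p /andP[pq _].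
    move: pq; rewrite mem_primes => /andP[/prime_gt0]; case: p => [//|p] _ _.
    by rewrite (le_trans _ (prime_wt_ge1 p)).
  apply: ler_pM; [exact: pos|exact: pos| |].
    rewrite -big_filter.
    rewrite [leLHS](perm_big [seq p <- index_iota 1 Y.+1 | prime p && (p %| q)%N]); last first.
      apply: uniq_perm; rewrite ?filter_uniq ?primes_uniq ?iota_uniq// => p.
      rewrite !mem_filter mem_primes mem_index_iota ltnS q0/=.
      case pp: (prime p) => //=; last by rewrite andbF.
      by rewrite (prime_gt0 pp) andbC.
    rewrite big_filter; apply: ler_prod => p /andP[pp _].
    have p2 : 2 <= p%:R :> R by rewrite ler_nat prime_gt1.
    rewrite addr_ge0 ?invr_ge0 ?lerD2l//=; last lra.
    have -> : p%:R / (p%:R - 1) ^+ 2 = (p%:R - 1)^-1 * (p%:R / (p%:R - 1)) :> R.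
      by field; rewrite gt_eqF; lra.
    by rewrite ler_peMr ?invr_ge0 ?ler_pdivlMr; lra.
  apply: (@le_trans _ _ (\prod_(p <- primes q | ~~ (p <= Y)%N) expR T%:R^-1)).
    apply: ler_prod => p; rewrite -ltnNge => Yp.
    have h : T%:R <= p%:R - 1 :> R.
      by rewrite lerBrDr natr1 ler_nat (leq_ltn_trans _ Yp)// leq_maxr.
    have T0 : 0 < T%:R :> R by rewrite ltr0n (ltn_trans _ T1).
    rewrite addr_ge0 ?invr_ge0//=; last lra.
    by rewrite (le_trans _ (expR_ge1Dx _))// lerD2l lef_pV2 ?posrE//; lra.
  rewrite -expR_sum ler_expR big_const_seq iter_addr_0 -[leLHS]mulr_natr.
  rewrite mulrC ler_pdivrMr ?ltr0n ?(ltn_trans _ T1)// mul1r ler_nat.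
  by rewrite (leq_trans _ sT)// count_size.
have Q0 : 0 <= Q by rewrite (le_trans _ (prod_primes_ge1 q)).
have L0 : 0 <= L by apply: sumr_ge0 => n _; rewrite divr_ge0// sieve_wt_ge0.
have hLQ : L * Q <= C * expR 1 * (ln X%:R + ln T%:R).
  apply: (le_trans (ler_pM L0 Q0 hL hQ)); rewrite mulrA -(mulrA C) (mulrC (expR 1)) (mulrA C).
  rewrite ler_pM2r ?expR_gt0//; have := hC Y Y1.
  rewrite (bigID (fun p => (p %| q)%N))/= mulrC => /le_trans; apply.
  rewrite ler_pM2l// -lnM ?posrE ?ltr0n ?(ltn_trans _ T1)//.
  rewrite ler_ln ?posrE ?mulr_gt0 ?ltr0n ?(ltn_trans _ T1) ?(ltn_trans _ Y1)//.
  by rewrite -natrM ler_nat geq_max leq_pmulr ?leq_pmull// (ltn_trans _ T1).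
have hG := halberstam_richert q X0; rewrite -/G -/L in hG.
rewrite -(ler_pM2l lX1) mulrA.
apply: (le_trans (ler_wpM2r Q0 hG)); rewrite -(mulrA _ L Q).
apply: (@le_trans _ _ (10 * X%:R * (C * expR 1 * (ln X%:R + ln T%:R)))).
  by rewrite ler_wpM2l ?mulr_ge0.
have -> : (1 + ln X%:R) * (10 * C * expR 1 * X%:R * (1 + ln T%:R / (1 + ln X%:R))) =
  10 * X%:R * (C * expR 1 * (1 + ln X%:R + ln T%:R)) by field; rewrite gt_eqF.
rewrite ler_wpM2l ?mulr_ge0// ler_wpM2l ?mulr_ge0 ?expR_ge0//; [exact: ltW|lra].
Qed.

End NumberTheory.

(** * Counting close pairs of reduced fractions *)

Section OverlapCount.
Context {R : realType}.
Implicit Types (a b m n p q d k g t A B : nat).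

Lemma sum_chinese (F H : nat -> R) A B : coprime A B -> (0 < A)%N -> (0 < B)%N ->
  \sum_(0 <= t < A * B) F (t %% A)%N * H (t %% B)%N =
  (\sum_(0 <= i < A) F i) * (\sum_(0 <= j < B) H j).
Proof.
move=> cAB A0 B0; rewrite !big_mkord big_distrlr/= pair_big/=.
pose f (t : 'I_(A * B)) : 'I_A * 'I_B :=
  (Ordinal (ltn_pmod t A0), Ordinal (ltn_pmod t B0)).
have fi : injective f.
  move=> s t [e1 e2]; apply/val_inj/eqP => /=.
  have := chinese_remainder cAB s t; rewrite e1 e2 !eqxx/= !modn_small//.
have fb : bijective f by apply: inj_card_bij => //; rewrite card_prod !card_ord.
by rewrite [RHS](reindex f)//=; exact: onW_bij.
Qed.

Lemma sum_sieve (u : nat -> nat -> R) (s : seq nat) : uniq s -> all prime s ->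
  \sum_(0 <= t < \prod_(p <- s) p) \prod_(p <- s) u p (t %% p)%N =
  \prod_(p <- s) \sum_(0 <= i < p) u p i.
Proof.
elim: s => [_ _|p s IH /= /andP[ps us] /andP[pp sp]].
  by rewrite !big_nil big_nat1 big_nil.
rewrite !big_cons -IH//; set M := (\prod_(r <- s) r)%N.
have M0 : (0 < M)%N.
  by rewrite /M big_seq prodn_cond_gt0// => r rs; rewrite prime_gt0// (allP sp).
have cpM : coprime p M.
  rewrite prime_coprime// /M; elim: s {IH us M M0} ps sp => [|r s IH].
    by rewrite big_nil dvdn1; case: eqP pp => // ->.
  rewrite inE negb_or big_cons /= => /andP[pr ps] /andP[pr' sp].
  by rewrite Euclid_dvdM// negb_or IH// andbT dvdn_prime2.
rewrite -(@sum_chinese (u p) (fun t => \prod_(r <- s) u r (t %% r)%N))// ?prime_gt0//.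
apply: eq_bigr => t _; rewrite big_cons; congr (_ * _).
rewrite big_seq [RHS]big_seq; apply: eq_bigr => r rs.
by rewrite modn_dvdm// /M (big_rem r)//= dvdn_mulr.
Qed.

(** The summand is periodic modulo the product of [s], which divides [g]; over one period the
    Chinese remainder theorem factors the sum. *)
Lemma sum_sieve_mul (u : nat -> nat -> R) (s : seq nat) g : uniq s -> all prime s ->
  (\prod_(p <- s) p %| g)%N ->
  \sum_(0 <= t < g) \prod_(p <- s) u p (t %% p)%N =
  g%:R * \prod_(p <- s) ((\sum_(0 <= i < p) u p i) / p%:R).
Proof.
move=> us sp /dvdnP[k ->]; set M := (\prod_(p <- s) p)%N.
have -> : \prod_(p <- s) ((\sum_(0 <= i < p) u p i) / p%:R) =
    (\prod_(p <- s) \sum_(0 <= i < p) u p i) / M%:R.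
  by rewrite big_split/= prodfV natr_prod.
have M0 : M%:R != 0 :> R.
  rewrite pnatr_eq0 -lt0n /M big_seq prodn_cond_gt0// => r rs.
  by rewrite prime_gt0// (allP sp).
set S := \prod_(p <- s) _.
have -> : (k * M)%:R * (S / M%:R) = k%:R * S by rewrite natrM; field.
rewrite /S -sum_sieve// big_nat_mul.
rewrite (eq_bigr (fun=> \sum_(0 <= t < M) \prod_(p <- s) u p (t %% p)%N)).
  by rewrite sumr_const_nat subn0 -[LHS]mulr_natl.
move=> i _; rewrite -[X in \big[_/_]_(X <= _ < _) _](add0n (i * M)%N) mulSn big_addn addnK.
apply: eq_bigr => t _; rewrite big_seq [RHS]big_seq; apply: eq_bigr => r rs.
rewrite -[in LHS]modnDmr (_ : (i * M) %% r = 0)%N ?addn0//.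
by apply/eqP; rewrite -/(dvdn r _) dvdn_mull// /M (big_rem r)//= dvdn_mulr.
Qed.

Lemma dvdn_prod_primes g : (0 < g)%N -> (\prod_(p <- primes g) p %| g)%N.
Proof.
move=> g0; rewrite [X in (_ %| X)%N]prod_prime_decomp// prime_decompE big_map/=.
rewrite big_seq [X in (_ %| X)%N]big_seq.
elim/big_ind2: _ => // [x1 x2 y1 y2|p]; first exact: dvdn_mul.
by rewrite -logn_gt0 => l0; rewrite dvdn_exp.
Qed.

Lemma prime_residue p x c : prime p -> ~~ (p %| c)%N ->
  exists2 i, (i < p)%N & (p %| x + i * c)%N.
Proof.
move=> pp pc; have p0 := prime_gt0 pp.
have : coprime c p by rewrite coprime_sym prime_coprime.
have [->|c0] := posnP c; first by rewrite /coprime gcd0n => /eqP ep; rewrite ep in pp.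
case/(coprimeP _ c0) => -[u v] /= e.
have euc : (u * c = 1 + v * p)%N by lia.
(* This is -x/c modulo [p]: [u] inverts [c], and [p.-1 * x] stands for -x among the naturals. *)
exists ((u * (p.-1 * x)) %% p)%N; first by rewrite ltn_pmod.
rewrite /dvdn -modnDmr modnMml modnDmr -/(dvdn p _).
have -> : (x + u * (p.-1 * x) * c = p * x + v * p * (p.-1 * x))%N.
  by rewrite mulnAC euc mulnDl mul1n addnA -mulSn prednK.
by apply: dvdn_add; [exact: dvdn_mulr|apply: dvdn_mulr; exact: dvdn_mull].
Qed.

Lemma sum_nat_eq (lo hi x : nat) :
  \sum_(lo <= j < hi) (j == x)%:R = (lo <= x < hi)%N%:R :> R.
Proof.
rewrite (eq_bigr (fun j => if j == x then 1 else 0)) => [|j _]; last by case: eqP.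
by rewrite -big_mkcond big_nat1_eq; case: ifP.
Qed.

Section PairCount.
Variables m n : nat.
Hypotheses (m0 : (0 < m)%N) (n0 : (0 < n)%N).
Local Notation g := (gcdn m n).
Local Notation m' := (m %/ g)%N.
Local Notation n' := (n %/ g)%N.

(* The equation [a * n' = b * m' + d] says that [a / m - b / n = d / lcmn m n]. *)
Definition pair_count d : R :=
  \sum_(1 <= a < m.+1 | coprime a m) \sum_(1 <= b < n.+1 | coprime b n)
    (a * n' == b * m' + d)%N%:R.

Let g0 : (0 < g)%N. Proof. by rewrite gcdn_gt0 m0. Qed.
Let mE : m = (g * m')%N. Proof. by rewrite mulnC divnK// dvdn_gcdl. Qed.
Let nE : n = (g * n')%N. Proof. by rewrite mulnC divnK// dvdn_gcdr. Qed.
Let m'0 : (0 < m')%N. Proof. by rewrite divn_gt0// dvdn_leq// dvdn_gcdl. Qed.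
Let n'0 : (0 < n')%N. Proof. by rewrite divn_gt0// dvdn_leq// dvdn_gcdr. Qed.
Let cmn : coprime m' n'.
Proof.
by rewrite /coprime -(eqn_pmul2l g0) muln_gcdr -mE -nE muln1.
Qed.

Lemma pair_count0_neq : m != n -> pair_count 0 = 0.
Proof.
move=> mn; rewrite /pair_count big1_seq// => a /andP[am]; rewrite mem_index_iota => /andP[a1 _].
rewrite big1// => b bn; rewrite addn0; case: eqP => // e; exfalso.
have m'1 : m' = 1%N.
  have : (m' %| a)%N by rewrite -(Gauss_dvdl _ cmn) e dvdn_mull.
  have : (m' %| m)%N by apply/dvdnP; exists g.
  by move=> h1 h2; apply/eqP; rewrite -dvdn1 -(eqP am) dvdn_gcd h1 h2.
have n'1 : n' = 1%N.
  have cnm : coprime n' m' by rewrite coprime_sym.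
  have : (n' %| b)%N by rewrite -(Gauss_dvdl _ cnm) -e dvdn_mull.
  have : (n' %| n)%N by apply/dvdnP; exists g.
  by move=> h1 h2; apply/eqP; rewrite -dvdn1 -(eqP bn) dvdn_gcd h1 h2.
by case/eqP: mn; rewrite [LHS]mE [RHS]nE m'1 n'1.
Qed.

(* The solutions of [a * n' = b * m' + d] are [(a0 + t * m', b0 + t * n')]; those with
   [a] coprime to [m] and [b] coprime to [n] avoid, for each prime [p] dividing [g], the
   residues [t] killing one of the two coordinates. *)
Let good a0 b0 p i : bool := ~~ (p %| (a0 + i * m') * (b0 + i * n'))%N.

(** The base point is the solution with the least admissible [a0], so that all shifts are natural
    numbers; a <= m = g m' then gives t < g. The last alternative is the case without admissible
    solutions. *)
Lemma pair_count_sieve d : exists a0 b0, (a0 * n' = b0 * m' + d)%N /\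
  pair_count d <= \sum_(0 <= t < g) \prod_(p <- primes g) (good a0 b0 p (t %% p))%N%:R
  \/ pair_count d = 0.
Proof.
pose P a := [&& (0 < a <= m)%N, coprime a m &
  has (fun b => coprime b n && (a * n' == b * m' + d)%N) (iota 1 n)].
have [hP|nP] := boolP (has P (iota 1 m)); last first.
  exists 0%N, 0%N; right; rewrite /pair_count big1_seq// => a /andP[am].
  rewrite mem_index_iota ltnS => ha; rewrite big1_seq// => b /andP[bn].
  rewrite mem_index_iota => hb; case: eqP => // e.
  case/hasP: nP; exists a; first by rewrite mem_iota add1n ltnS.
  apply/and3P; split => //; apply/hasP; exists b; first by rewrite mem_iota add1n.
  by rewrite bn e eqxx.
have exP : exists a, P a by case/hasP: hP => a _; exists a.
case: (ex_minnP exP) => a0 /and3P[/andP[a1 am] ca /hasP[b0 hb /andP[cb /eqP e0]]] mina.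
exists a0, b0; left; split => //.
have key a b : (0 < a <= m)%N -> coprime a m -> (0 < b <= n)%N -> coprime b n ->
    (a * n' = b * m' + d)%N ->
    exists2 t, (t < g)%N & a = (a0 + t * m')%N /\ b = (b0 + t * n')%N.
  move=> ha cam hbn cbn e.
  have a0a : (a0 <= a)%N.
    apply: mina; apply/and3P; split => //; apply/hasP; exists b.
      by rewrite mem_iota add1n ltnS.
    by rewrite cbn e eqxx.
  have b0b : (b0 <= b)%N.
    by rewrite -(leq_pmul2r m'0) -(leq_add2r d) -e -e0 leq_mul2r a0a orbT.
  have ee : ((a - a0) * n' = (b - b0) * m')%N by rewrite !mulnBl; lia.
  have : (m' %| a - a0)%N by rewrite -(Gauss_dvdl _ cmn) ee dvdn_mull.
  case/dvdnP => t et; exists t.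
    rewrite -(ltn_pmul2r m'0) -et -mE; lia.
  split; first by rewrite -et subnKC.
  apply/eqP; rewrite -(eqn_add2r (0 - b0)) -(subnKC b0b) eqn_add2r eqn_add2l.
  by rewrite -(eqn_pmul2r m'0) -ee et mulnAC.
pose F t : R := \prod_(p <- primes g) (good a0 b0 p (t %% p))%N%:R.
have F0 t : 0 <= F t by apply: prodr_ge0.
(* Each counted pair is charged to its shift [t]; after exchanging the sums, each [t] is charged by
   at most one pair. *)
apply: (@le_trans _ _ (\sum_(1 <= a < m.+1) \sum_(1 <= b < n.+1) \sum_(0 <= t < g)
   ((a == a0 + t * m')%N%:R * ((b == b0 + t * n')%N%:R * F t)))).
  rewrite /pair_count big_mkcond/=; apply: ler_sum_nat => a ha.
  have nn b t : 0 <= (a == a0 + t * m')%N%:R * ((b == b0 + t * n')%N%:R * F t).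
    by rewrite !mulr_ge0.
  case: ifP => cam; last by do 2!apply: sumr_ge0 => ? _.
  rewrite big_mkcond/=; apply: ler_sum_nat => b hb'.
  case: ifP => cbn; last by apply: sumr_ge0 => ? _.
  case: eqP => [e|_]; last by apply: sumr_ge0 => ? _.
  have [t tg [ea eb]] := key a b ha cam hb' cbn e.
  rewrite (big_cat_nat (n := t))//=; last exact: ltnW.
  rewrite [X in _ + X]big_ltn// -ea -eb !eqxx !mul1r.
  suff -> : F t = 1 by rewrite addrCA lerDl addr_ge0// sumr_ge0.
  rewrite /F big1_seq// => p /andP[_]; rewrite mem_primes => /and3P[pp _ pg].
  rewrite /good Euclid_dvdM//.
  have h x c : (p %| x + t %% p * c)%N = (p %| x + t * c)%N.
    by rewrite /dvdn -modnDmr modnMml modnDmr.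
  rewrite !h -ea -eb.
  have -> : (p %| a)%N = false.
    apply/negP => pa; have : (p %| gcdn a m)%N.
      by rewrite dvdn_gcd pa (dvdn_trans pg (dvdn_gcdl _ _)).
    by rewrite (eqP cam) dvdn1; case: eqP pp => // ->.
  have -> // : (p %| b)%N = false.
  apply/negP => pa; have : (p %| gcdn b n)%N by rewrite dvdn_gcd pa (dvdn_trans pg (dvdn_gcdr _ _)).
  by rewrite (eqP cbn) dvdn1; case: eqP pp => // ->.
under eq_bigr do rewrite exchange_big_nat/=.
rewrite exchange_big_nat/=; apply: ler_sum_nat => t tg.
under eq_bigr do rewrite -mulr_sumr -mulr_suml.
rewrite -mulr_suml mulrA.
have h1 x N : \sum_(1 <= a < N.+1) (a == x)%:R <= 1 :> R.
  by rewrite sum_nat_eq lern1 leq_b1.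
have h0 x N : 0 <= \sum_(1 <= a < N.+1) (a == x)%:R :> R by apply: sumr_ge0.
rewrite -[leRHS]mul1r ler_wpM2r// -[leRHS]mulr1 ler_pM//.
Qed.

(** If [p] divides m' or n', the other coordinate still vanishes for one residue. Otherwise each
    coordinate vanishes for one residue, and the two can coincide only if [p] divides [d]; two
    excluded residues leave p - 2 <= (p - 1)(1 - 1/p). *)
Lemma sum_good_le a0 b0 d p : (a0 * n' = b0 * m' + d)%N -> prime p ->
  \sum_(0 <= i < p) (good a0 b0 p i)%:R <=
    (p%:R - 1 : R) * (if (p %| m' * n')%N || (p %| d)%N then 1 else (1 - p%:R^-1)).
Proof.
move=> e pp; have p2 : 2 <= p%:R :> R by rewrite ler_nat prime_gt1.
have p0 : 0 < p%:R :> R by lra.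
have sumE (i : nat) : (i < p)%N -> \sum_(0 <= j < p) (j == i)%:R = 1 :> R.
  by move=> ip; rewrite sum_nat_eq ip.
have one i : (i < p)%N -> ~~ good a0 b0 p i ->
    \sum_(0 <= i < p) (good a0 b0 p i)%:R <= p%:R - 1 :> R.
  move=> ip gi; have -> : p%:R - 1 = \sum_(0 <= j < p) (1 - (j == i)%:R) :> R.
    by rewrite sumrB sumE// sumr_const_nat subn0.
  apply: ler_sum_nat => j _.
  case: eqP => [->|_]; first by rewrite (negbTE gi) subrr.
  by rewrite subr0 lern1 leq_b1.
have [pm|pm] := boolP (p %| m')%N.
  rewrite dvdn_mulr//= mulr1.
  have pn : ~~ (p %| n')%N.
    apply/negP => pn; have : (p %| gcdn m' n')%N by rewrite dvdn_gcd pm.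
    by rewrite (eqP cmn) dvdn1; case: eqP pp => // ->.
  have [i ip hi] := prime_residue b0 pp pn.
  by apply: (one i ip); rewrite /good negbK dvdn_mull.
have [i ip hi] := prime_residue a0 pp pm.
have gi : ~~ good a0 b0 p i by rewrite /good negbK dvdn_mulr.
have [pn|pn] := boolP (p %| n')%N.
  by rewrite dvdn_mull//= mulr1; apply: (one i).
rewrite Euclid_dvdM// (negbTE pm) (negbTE pn)/=.
have [pd|pd] := boolP (p %| d)%N; first by rewrite mulr1; apply: (one i).
have [j jp hj] := prime_residue b0 pp pn.
have gj : ~~ good a0 b0 p j by rewrite /good negbK dvdn_mull.
have ij : i != j.
  apply/negP => /eqP ij; subst j; case/negP: pd.
  have ee : ((a0 + i * m') * n' = (b0 + i * n') * m' + d)%N.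
    by rewrite !mulnDl e -addnA (addnC d) addnA mulnAC.
  by rewrite -(@dvdn_addr ((b0 + i * n') * m')%N)// ?dvdn_mulr// -ee dvdn_mulr.
apply: (@le_trans _ _ (p%:R - 1 - 1)).
  have -> : p%:R - 1 - 1 = \sum_(0 <= k < p) (1 - (k == i)%:R - (k == j)%:R) :> R.
    by rewrite !sumrB !sumE// sumr_const_nat subn0.
  apply: ler_sum_nat => k _.
  case: eqP => [->|_].
    by rewrite (negbTE gi) (negbTE ij) subr0 subrr.
  rewrite subr0; case: eqP => [->|_]; first by rewrite (negbTE gj) subrr.
  by rewrite subr0 lern1 leq_b1.
have -> : (p%:R - 1) * (1 - p%:R^-1) = p%:R - 1 - 1 + p%:R^-1 :> R by field; rewrite gt_eqF.
by rewrite lerDl invr_ge0 ltW.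
Qed.

(** A common divisor of [d] and m' divides a n', hence [a], as it is coprime to n'; but it also
    divides [m]. The same argument applies to n'. Thus only [d] coprime to m'n' contribute, which is
    why a sieve over [d] is possible. *)
Lemma coprime_pair d a b : coprime a m -> coprime b n ->
  (a * n' = b * m' + d)%N -> (0 < d)%N -> coprime d (m' * n').
Proof.
move=> am bn e d0; rewrite coprimeMr; apply/andP; split.
  rewrite /coprime; set h := gcdn d m'; have hm : (h %| m')%N by rewrite dvdn_gcdr.
  have : (h %| a * n')%N by rewrite e dvdn_add// ?dvdn_mull// dvdn_gcdl.
  have chn : coprime h n' by apply: coprime_dvdl cmn.
  rewrite Gauss_dvdl// => ha.
  have : (h %| gcdn a m)%N by rewrite dvdn_gcd ha mE dvdn_mull.
  by rewrite (eqP am) dvdn1.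
rewrite /coprime; set h := gcdn d n'; have hn : (h %| n')%N by rewrite dvdn_gcdr.
have : (h %| b * m')%N.
  by rewrite -(@dvdn_addl d)// ?dvdn_gcdl// -e dvdn_mull.
have chm : coprime h m' by apply: coprime_dvdl hn _; rewrite coprime_sym.
rewrite Gauss_dvdl// => hb.
have : (h %| gcdn b n)%N by rewrite dvdn_gcd hb nE dvdn_mull.
by rewrite (eqP bn) dvdn1.
Qed.

End PairCount.

(** Brings products over the primes of several integers to the primes of one common multiple, where
    they can be compared prime by prime. *)
Lemma prod_primes_dvd (F : nat -> R) k Z : (0 < Z)%N -> (k %| Z)%N ->
  \prod_(p <- primes k) F p = \prod_(p <- primes Z) (if (p %| k)%N then F p else 1).
Proof.
move=> Z0 kZ; have k0 : (0 < k)%N by rewrite (dvdn_gt0 Z0).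
rewrite -big_mkcond/= -[RHS]big_filter; apply: perm_big; apply: uniq_perm.
- exact: primes_uniq.
- by rewrite filter_uniq// primes_uniq.
move=> p; rewrite mem_filter !mem_primes k0 Z0/= andbCA.
by case pk: (p %| k)%N; rewrite ?andbF//= (dvdn_trans pk kZ).
Qed.

Lemma totient_ratio n : (0 < n)%N ->
  (totient n)%:R / n%:R = \prod_(p <- primes n) (1 - p%:R^-1) :> R.
Proof.
move=> n0; rewrite totientE// [X in _ / X%:R]prod_prime_decomp// prime_decompE big_map/=.
rewrite !natr_prod -prodf_div big_seq [RHS]big_seq; apply: eq_bigr => p pn.
have pp : prime p by move: pn; rewrite mem_primes => /andP[].
have : (0 < logn p n)%N by rewrite logn_gt0.
case: (logn p n) => // k _; rewrite expnS !natrM/=.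
have p0 : (p ^ k)%:R != 0 :> R by rewrite pnatr_eq0 -lt0n expn_gt0 prime_gt0.
have p1 : p%:R != 0 :> R by rewrite pnatr_eq0 -lt0n prime_gt0.
by rewrite -subn1 natrB ?prime_gt0//; field; rewrite p0 p1.
Qed.

(** For [d] coprime to m'n' both sides are products over the primes of [Z]. Put x = 1 - 1/p. A prime
    of g contributes at most x to the sieve, and at most x^2 if it divides neither m'n' nor [d]; on
    the right the totient ratios give x^2, and a factor x^-1 is returned if p divides m'n' or [d].
    For p not dividing g the right-hand factor is at least 1. *)
Lemma pair_count_le m n d : (0 < m)%N -> (0 < n)%N -> (0 < d)%N ->
  pair_count m n d <= (gcdn m n)%:R * ((totient m)%:R / m%:R) * ((totient n)%:R / n%:R) *
    \prod_(p <- primes (m %/ gcdn m n * (n %/ gcdn m n))) (1 + (p%:R - 1)^-1) *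
    sieve_wt (m %/ gcdn m n * (n %/ gcdn m n))%N d :> R.
Proof.
move=> m0 n0 d0; set g := gcdn m n; set m' := (m %/ g)%N; set n' := (n %/ g)%N.
have g0 : (0 < g)%N by rewrite gcdn_gt0 m0.
have gm : (g %| m)%N by rewrite dvdn_gcdl.
have gn : (g %| n)%N by rewrite dvdn_gcdr.
have mE : m = (g * m')%N by rewrite mulnC divnK.
have nE : n = (g * n')%N by rewrite mulnC divnK.
have m'0 : (0 < m')%N by rewrite divn_gt0// dvdn_leq.
have n'0 : (0 < n')%N by rewrite divn_gt0// dvdn_leq.
set RH := (X in _ <= X).
have RH0 : 0 <= RH.
  apply: mulr_ge0; last exact: sieve_wt_ge0.
  apply: mulr_ge0; last by rewrite (le_trans _ (prod_primes_ge1 _)).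
  by rewrite !mulr_ge0 ?invr_ge0.
have [cd|ncd] := boolP (coprime d (m' * n')); last first.
  rewrite /pair_count big1_seq// => a /andP[am _]; rewrite big1// => b bn.
  case: eqP => // e; exfalso; case/negP: ncd; by apply: coprime_pair am bn e d0.
have [a0 [b0 [[e h]|->//]]] := pair_count_sieve m0 n0 d.
apply: (le_trans h) => {h}.
rewrite (sum_sieve_mul (fun p i => (~~ (p %| (a0 + i * m') * (b0 + i * n'))%N)%:R)); first last.
- exact: dvdn_prod_primes.
- by apply/allP => p; rewrite mem_primes => /andP[].
- exact: primes_uniq.
rewrite /RH !totient_ratio// /sieve_wt cd mul1r -!mulrA ler_wpM2l//.
pose Z := (m * n * d)%N.
have Z0 : (0 < Z)%N by rewrite !muln_gt0 m0 n0 d0.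
rewrite (@prod_primes_dvd _ g Z)//; last by rewrite /Z -mulnA dvdn_mulr.
rewrite (@prod_primes_dvd _ m Z)//; last by rewrite /Z -mulnA dvdn_mulr.
rewrite (@prod_primes_dvd _ n Z)//; last by rewrite /Z dvdn_mulr// dvdn_mull.
rewrite (@prod_primes_dvd _ (m' * n') Z)//; last first.
  by rewrite /Z dvdn_mulr// mE nE dvdn_mul// dvdn_mull.
rewrite (@prod_primes_dvd _ d Z)//; last by rewrite /Z dvdn_mull.
rewrite -!big_split/= big_seq [leRHS]big_seq; apply: ler_prod => p.
rewrite mem_primes => /andP[pp _].
have p2 : 2 <= p%:R :> R by rewrite ler_nat prime_gt1.
apply/andP; split.
  by case: ifP => // _; rewrite divr_ge0// sumr_ge0.
have x0 : 0 < 1 - p%:R^-1 :> R.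
  rewrite subr_gt0 invf_lt1; lra.
have x1 : 1 - p%:R^-1 <= 1 :> R by rewrite gerBl invr_ge0; lra.
have -> : 1 + (p%:R - 1)^-1 = (1 - p%:R^-1)^-1 :> R.
  by field; rewrite !gt_eqF//; lra.
have hs : (\sum_(0 <= i < p) (~~ (p %| (a0 + i * m') * (b0 + i * n'))%N)%:R) / p%:R <=
   (1 - p%:R^-1) * (if (p %| m' * n')%N || (p %| d)%N then 1 else (1 - p%:R^-1)) :> R.
  rewrite ler_pdivrMr; last lra.
  apply: (le_trans (sum_good_le m0 e pp)).
  rewrite mulrAC le_eqVlt; apply/orP; left; apply/eqP; congr (_ * _).
  by rewrite mulrBl mul1r mulVf// pnatr_eq0 -lt0n prime_gt0.
set x := 1 - _ in x0 x1 hs *.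
have x1' : 1 <= x^-1 by rewrite invf_ge1.
have pmn : (p %| m' * n')%N = (p %| m')%N || (p %| n')%N by rewrite Euclid_dvdM.
have pgE : (p %| g)%N = (p %| m)%N && (p %| n)%N by rewrite dvdn_gcd.
have pmE : (p %| m)%N = (p %| g)%N || (p %| m')%N by rewrite {1}mE Euclid_dvdM.
have pnE : (p %| n)%N = (p %| g)%N || (p %| n')%N by rewrite {1}nE Euclid_dvdM.
have xx : x * x^-1 = 1 by rewrite mulfV// gt_eqF.
have dd : 1 <= (if (p %| d)%N then x^-1 else 1) by case: ifP.
move: hs pgE; rewrite pmE pnE pmn.
case: (p %| g)%N => /=.
  move=> hs _; apply: (le_trans hs) => {hs}.
  rewrite ler_pM2l//; case: ((p %| m')%N || (p %| n')%N) => /=; first by rewrite mulrA xx mul1r.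
  by case: ifP => _; rewrite mul1r ?mulr1 ?xx.
move=> _; case: (p %| m')%N => /=; case: (p %| n')%N => //= _; rewrite ?mul1r ?mulr1//.
- by rewrite mulrA xx mul1r.
- by rewrite mulrA xx mul1r.
Qed.

Definition kappa (T : nat) (Y : R) : R :=
  if 1 <= Y then 1 + ln T%:R / (1 + ln Y) else 0.

Lemma kappa_ge0 T Y : 0 <= kappa T Y.
Proof.
rewrite /kappa; case: ifP => // Y1.
by rewrite addr_ge0// divr_ge0 ?ln_nat_ge0// addr_ge0// ln_ge0.
Qed.

Lemma sum_coprime n : \sum_(1 <= b < n.+1 | coprime b n) 1 = (totient n)%:R :> R.
Proof.
rewrite totient_count_coprime natr_sum big_mkord.
case: n => [|n]; first by rewrite big_geq// big_ord0.
rewrite big_mkcond big_nat_recr//= -(big_mkord xpredT (fun i => (coprime n.+1 i)%:R)).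
rewrite [RHS]big_ltn// addrC; congr (_ + _).
  by rewrite /coprime gcdnn gcdn0; case: eqP.
by apply: eq_bigr => i _; rewrite coprime_sym; case: ifP.
Qed.

Definition overlap_count m n (D : R) : R :=
  \sum_(1 <= a < m.+1 | coprime a m) \sum_(1 <= b < n.+1 | coprime b n)
    (`|a%:R / m%:R - b%:R / n%:R| < D)%R%:R.

(** Differences of the fractions are multiples of 1 / lcm. The two orders of subtraction give the
    two counts; the difference 0 is counted once only. *)
Lemma overlap_count_le m n (D : R) X : (0 < m)%N -> (0 < n)%N ->
  D * m%:R * n%:R / (gcdn m n)%:R < X.+1%:R ->
  overlap_count m n D <= pair_count m n 0 +
    \sum_(1 <= d < X.+1) pair_count m n d + \sum_(1 <= d < X.+1) pair_count n m d.
Proof.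
move=> m0 n0 hX; set g := gcdn m n in hX *.
have g0 : (0 < g)%N by rewrite gcdn_gt0 m0.
set m' := (m %/ g)%N; set n' := (n %/ g)%N.
have mE : m = (g * m')%N by rewrite mulnC divnK// dvdn_gcdl.
have nE : n = (g * n')%N by rewrite mulnC divnK// dvdn_gcdr.
pose E1 a b := \sum_(0 <= d < X.+1) (a * n' == b * m' + d)%N%:R : R.
pose E2 a b := \sum_(1 <= d < X.+1) (b * m' == a * n' + d)%N%:R : R.
have hE a b : (`|a%:R / m%:R - b%:R / n%:R| < D)%R%:R <= E1 a b + E2 a b.
  have E10 : 0 <= E1 a b by apply: sumr_ge0.
  have E20 : 0 <= E2 a b by apply: sumr_ge0.
  have [lt|_] := boolP (_ < D); last by rewrite addr_ge0.
  have m'0 : m'%:R != 0 :> R by rewrite pnatr_eq0 -lt0n; move: m0; rewrite mE muln_gt0 => /andP[].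
  have n'0 : n'%:R != 0 :> R by rewrite pnatr_eq0 -lt0n; move: n0; rewrite nE muln_gt0 => /andP[].
  have g0' : 0 < g%:R :> R by rewrite ltr0n.
  have h : `|(a * n')%:R - (b * m')%:R| < X.+1%:R :> R.
    apply: le_lt_trans hX.
    have -> : (a * n')%:R - (b * m')%:R = (a%:R / m%:R - b%:R / n%:R) * (m%:R * n%:R / g%:R) :> R.
      rewrite [in RHS]mE [in RHS]nE !natrM; field; rewrite m'0 n'0 gt_eqF//.
    have -> : D * m%:R * n%:R / g%:R = D * (m%:R * n%:R / g%:R) by rewrite !mulrA.
    have q0 : 0 <= m%:R * n%:R / g%:R :> R by rewrite divr_ge0 ?mulr_ge0.
    by rewrite normrM (ger0_norm q0) ler_wpM2r// ltW.
  have [ba|ab] := leqP (b * m') (a * n').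
    rewrite -[leLHS]addr0 lerD//.
    rewrite /E1 (eq_bigr (fun d => (d == a * n' - b * m')%N%:R)) => [|d _].
      rewrite sum_nat_eq /= (_ : (_ < _)%N = true)//.
      by move: h; rewrite -natrB// normr_nat ltr_nat.
    congr (_%:R); congr (nat_of_bool _).
    by move: (a * n')%N (b * m')%N ba => u v vu; apply/eqP/eqP => ->; rewrite ?addKn ?subnKC.
  rewrite -[leLHS]add0r lerD//.
  rewrite /E2 (eq_bigr (fun d => (d == b * m' - a * n')%N%:R)) => [|d _].
    rewrite sum_nat_eq subn_gt0 ab /= (_ : (_ < _)%N = true)//.
    by move: h; rewrite distrC -(natrB _ (ltnW ab)) normr_nat ltr_nat.
  congr (_%:R); congr (nat_of_bool _).
  by move: (a * n')%N (b * m')%N (ltnW ab) => u v vu; apply/eqP/eqP => ->; rewrite ?addKn ?subnKC.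
apply: (@le_trans _ _ (\sum_(1 <= a < m.+1 | coprime a m)
   \sum_(1 <= b < n.+1 | coprime b n) (E1 a b + E2 a b))).
  by do 2!apply: ler_sum => ? _.
rewrite le_eqVlt; apply/orP; left; apply/eqP.
under eq_bigr do rewrite big_split/=.
rewrite big_split/=; congr (_ + _).
  rewrite -(big_ltn (m := 0) (n := X.+1) (F := fun d => pair_count m n d))//.
  under eq_bigr do rewrite exchange_big_nat/=.
  by rewrite exchange_big_nat/=.
under eq_bigr do rewrite exchange_big_nat/=.
rewrite exchange_big_nat/=; apply: eq_bigr => d _.
rewrite /pair_count gcdnC -/g -/m' -/n' exchange_big_nat/=.
by [].
Qed.

(** Y bounds (r + s) lcm, so the multiples [d] run up to its integer part X. By [sieve_bound] each
    sign contributes at most a constant times A Y [kappa], and min r s * max r s = r s cancels the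
    denominators hidden in A and Y. Difference 0 forces m = n and gives the first term. *)
Lemma overlap_bound : exists2 C : R, 0 < C & forall T m n (r s : R),
  (0 < m)%N -> (0 < n)%N -> (m * n <= 2 ^ T)%N -> (1 < T)%N -> 0 <= r -> 0 <= s ->
  2 * Num.min r s * overlap_count m n (r + s) <=
    (m == n)%:R * (2 * r * (totient n)%:R) +
    C * (r * (totient m)%:R) * (s * (totient n)%:R) *
      kappa T (2 * Num.max r s * m%:R * n%:R / (gcdn m n)%:R).
Proof.
have [C C0 hC] := @sieve_bound R; exists (16 * C); first by rewrite mulr_gt0.
move=> T m n r s m0 n0 mnT T1 r0 s0.
set g := gcdn m n; set Y := 2 * Num.max r s * m%:R * n%:R / g%:R.
have g0 : (0 < g)%N by rewrite gcdn_gt0 m0.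
have g0' : 0 < g%:R :> R by rewrite ltr0n.
have m0' : 0 < m%:R :> R by rewrite ltr0n.
have n0' : 0 < n%:R :> R by rewrite ltr0n.
set m' := (m %/ g)%N; set n' := (n %/ g)%N.
have mE : m = (g * m')%N by rewrite mulnC divnK// dvdn_gcdl.
have nE : n = (g * n')%N by rewrite mulnC divnK// dvdn_gcdr.
have mM0 : 0 <= Num.max r s by rewrite le_max r0.
have mm0 : 0 <= Num.min r s by rewrite le_min r0.
have Y0 : 0 <= Y by rewrite !mulr_ge0 ?invr_ge0.
have /andP[X1 X2] := truncn_itv Y0; set X := Num.trunc Y in X1 X2.
have hD : (r + s) * m%:R * n%:R / g%:R < X.+1%:R.
  apply: le_lt_trans X2; rewrite !ler_pM2r ?invr_gt0// mulrDl mul1r.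
  by rewrite lerD// le_max lexx ?orbT.
have h1 := overlap_count_le m0 n0 hD.
set P := \prod_(p <- primes (m' * n')) (1 + (p%:R - 1)^-1) : R.
set A := g%:R * ((totient m)%:R / m%:R) * ((totient n)%:R / n%:R) : R.
have A0 : 0 <= A by rewrite !mulr_ge0 ?invr_ge0.
set W := \sum_(1 <= d < X.+1) sieve_wt (m' * n') d : R.
have P1 : \sum_(1 <= d < X.+1) pair_count m n d <= A * P * W.
  rewrite mulr_sumr; apply: ler_sum_nat => d /andP[d0 _]; exact: pair_count_le.
have P2 : \sum_(1 <= d < X.+1) pair_count n m d <= A * P * W.
  rewrite mulr_sumr; apply: ler_sum_nat => d /andP[d0 _].
  have := @pair_count_le n m d n0 m0 d0; rewrite gcdnC -/g -/m' -/n' (mulnC n' m').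
  by rewrite /A (mulrAC g%:R).
have P0 : pair_count m n 0 <= (m == n)%:R * (totient n)%:R :> R.
  have [emn|mn] := eqVneq m n; last by rewrite pair_count0_neq// mul0r.
  rewrite mul1r -sum_coprime /pair_count emn gcdnn divnn n0.
  rewrite exchange_big_nat/=; apply: ler_sum => b _.
  rewrite big_mkcond/= (@le_trans _ _ (\sum_(1 <= a < n.+1) (a == b)%:R))//.
    apply: ler_sum => a _; rewrite !muln1 addn0; by case: ifP.
  by rewrite sum_nat_eq lern1 leq_b1.
have fin : 2 * Num.min r s * (2 * (A * P * W)) <=
   16 * C * (r * (totient m)%:R) * (s * (totient n)%:R) * kappa T Y.
  have rs : Num.min r s * Num.max r s = r * s by case: (leP r s) => _; rewrite // mulrC.
  have [X0|X0] := posnP X.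
    rewrite /W X0 big_geq// !mulr0.
    by rewrite !mulr_ge0 ?kappa_ge0// ltW.
  have X0' : 1 <= X%:R :> R by rewrite ler1n.
  have Y1 : 1 <= Y by apply: le_trans X1.
  have q1 : (0 < m' * n' <= 2 ^ T)%N.
    rewrite (leq_trans _ mnT) ?andbT; last by rewrite leq_mul// leq_div.
    by move: m0 n0; rewrite mE nE !muln_gt0 => /andP[_ ->] /andP[_ ->].
  have hW := hC _ _ _ q1 T1 X0; rewrite -/W -/P in hW.
  have lX : ln Y - 1 <= ln X%:R.
    have : ln Y <= ln (2 * X%:R).
      rewrite ler_ln ?posrE; [|lra|lra].
      move: X2; rewrite -natr1; lra.
    rewrite lnM ?posrE//; last by lra.
    have := @ln2_le1 R; lra.
  have lX0 : 0 <= ln X%:R :> R by exact: ln_nat_ge0.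
  have lY0 : 0 <= ln Y by exact: ln_ge0.
  have lT0 : 0 <= ln T%:R :> R by exact: ln_nat_ge0.
  (* From ln X >= ln Y - 1 and ln X >= 0 follows 1 + ln X >= (1 + ln Y) / 2. *)
  have hk : 1 + ln T%:R / (1 + ln X%:R) <= 2 * kappa T Y.
    rewrite /kappa Y1 mulrDr mulr1 lerD//; first lra.
    rewrite mulrCA ler_wpM2l// -[leRHS]invrK lef_pV2 ?posrE; last 2 first.
    - lra.
    - by rewrite invr_gt0 mulr_gt0// invr_gt0; lra.
    - by rewrite invfM invrK; lra.
  have hWP : W * P <= C * Y * (2 * kappa T Y).
    apply: (le_trans hW); apply: ler_pM => //.
    - by rewrite mulr_ge0// ltW.
    - by rewrite addr_ge0// divr_ge0//; lra.
    - by rewrite ler_pM2l.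
  have -> : 2 * Num.min r s * (2 * (A * P * W)) = 4 * (Num.min r s * A) * (W * P) by ring.
  have -> : 16 * C * (r * (totient m)%:R) * (s * (totient n)%:R) * kappa T Y =
     4 * (Num.min r s * A) * (C * Y * (2 * kappa T Y)).
    have -> : 16 * C * (r * (totient m)%:R) * (s * (totient n)%:R) * kappa T Y =
       16 * C * ((totient m)%:R) * ((totient n)%:R) * kappa T Y * (r * s) by ring.
    by rewrite -rs /Y /A; field; rewrite !gt_eqF.
  by apply: ler_wpM2l => //; apply: mulr_ge0 => //; exact: mulr_ge0.
have -> : (m == n)%:R * (2 * r * (totient n)%:R) =
   2 * Num.min r s * ((m == n)%:R * (totient n)%:R) +
   ((m == n)%:R * (2 * (r - Num.min r s) * (totient n)%:R)) by ring.
rewrite -addrA (le_trans (ler_wpM2l _ h1)) ?mulr_ge0//.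
rewrite -addrA mulrDr lerD//; first by rewrite ler_wpM2l ?mulr_ge0.
rewrite -[leLHS]add0r lerD//.
  by rewrite !mulr_ge0// subr_ge0 ge_min lexx.
by apply: le_trans fin; rewrite ler_wpM2l ?mulr_ge0// mulr2n mulrDl mul1r lerD.
Qed.

End OverlapCount.

(** * A zero-one law and a second moment inequality *)

Section LebesgueAffine.
Context {R : realType}.
Local Notation mu := (@lebesgue_measure R).
Implicit Types (A : set R) (x y a b c r : R).

Lemma measurable_affine c b :
  measurable_fun [set: R] ((fun x => c * x + b) : measurableTypeR R -> measurableTypeR R).
Proof.
apply: measurable_funD; last exact: measurable_cst.
by apply: measurable_funM => //; exact: measurable_cst.
Qed.

Lemma measurable_preimage_affine c b A :
  measurable (A : set (measurableTypeR R)) ->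
  measurable ((fun x : R => c * x + b) @^-1` A : set (measurableTypeR R)).
Proof.
by move=> mA; rewrite -[X in measurable X]setTI; exact: measurable_affine.
Qed.

Lemma lebesgue_preimage_affine c b A : 0 < c ->
  measurable (A : set (measurableTypeR R)) ->
  (c%:E * mu ((fun x => (c * x + b)%R) @^-1` A) = mu A)%E.
Proof.
move=> c0 mA.
pose f : measurableTypeR R -> measurableTypeR R := fun x => c * x + b.
pose m :=
  measure_function_pushforward__canonical__measure_function_Measure mu (measurable_affine c b).
pose m2 : {measure set (measurableTypeR R) -> \bar R} := mscale (NngNum (ltW c0)) m.
apply/esym; apply: (@lebesgue_measure_unique R m2) => // _ [[u v]] _ <-.
have E : (fun x : R => c * x + b) @^-1` `]u, v]%classic =
    `](u - b) / c, (v - b) / c]%classic.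
  apply/seteqP; split => x /=;
    rewrite !in_itv/= ltr_pdivrMr// ler_pdivlMr// (mulrC x) => /andP[]; lra.
change (mu `]u, v] = (c%:E * mu ((fun x => (c * x + b)%R) @^-1` `]u, v]))%E); rewrite E.
rewrite !lebesgue_measure_itv/= !lte_fin ltr_pM2r ?invr_gt0// ltrD2r.
case: ifPn => _; last by rewrite mule0.
rewrite -!EFinD -EFinM; congr (_%:E).
by field; rewrite gt_eqF.
Qed.

Lemma lebesgue_preimage_shift b A :
  measurable (A : set (measurableTypeR R)) ->
  mu ((fun x => x + b) @^-1` A) = mu A.
Proof.
move=> mA; rewrite -[RHS](@lebesgue_preimage_affine 1 b A)// mul1e.
by have -> // : (fun x => x + b) = (fun x => 1 * x + b) by apply/funext => x; rewrite mul1r.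
Qed.

Definition dyadic (k : nat) (i : int) : set R :=
  `[i%:~R / 2 ^+ k, (i + 1)%:~R / 2 ^+ k[%classic.

Lemma measurable_dyadic k i : measurable (dyadic k i : set (measurableTypeR R)).
Proof. exact: measurable_itv. Qed.

(** At a density point x, the dyadic cell of length 2^-k containing x lies in the ball of radius
    2^-k. The ball is twice as long, so relative defect e/2 in the ball suffices. *)
Lemma exists_dense_dyadic A (e : R) :
  measurable (A : set (measurableTypeR R)) -> mu A <> 0%E -> 0 < e ->
  exists k i, (mu (dyadic k i `\` A) <= (e / 2 ^+ k)%:E)%E.
Proof.
move=> mA A0 e0.
have [x [Ax hx]] : exists x, A x /\
    ((mu (A `&` ball x r) * (mu (ball x r))^-1)%E @[r --> 0^'+] --> (1%:E : \bar R)).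
  apply: contrapT => /forallNP h; apply: A0.
  apply: (measure_negligible mA); apply: negligibleS (lebesgue_density mA).
  move=> x Ax /= hx; apply: (h x); split => //.
  by move: hx; rewrite indicE mem_set.
have e2 : (1 - (e / 2)%:E < (1%:E : \bar R))%E by rewrite -EFinB lte_fin; lra.
have hd : \forall r \near ((0:R)^'+), ((1 - e / 2)%:E < mu (A `&` ball x r) * (mu (ball x r))^-1)%E.
  have hn : nbhs (1%:E : \bar R) [set y | ((1 - e / 2)%:E < y)%E].
    by apply: (@nbhs_open_ereal_gt R 1 (fun=> 1 - e / 2)); lra.
  exact: (hx _ hn).
have [d /= d0 {}hd] := hd.
have [k hk] : exists k, 2 ^- k < d.
  exists (Num.bound d^-1); rewrite -[ltRHS]invrK ltf_pV2 ?posrE ?invr_gt0 ?exprn_gt0//.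
  exact: upper_nthrootP.
pose i := Num.floor (x * 2 ^+ k).
exists k, i.
have r0 : 0 < 2 ^- k :> R by rewrite invr_gt0 exprn_gt0.
have {}hd : ((1 - e / 2)%:E < mu (A `&` ball x (2 ^- k)) * (mu (ball x (2 ^- k)))^-1)%E.
  by apply: hd => //=; rewrite sub0r normrN gtr0_norm.
have mb : measurable (ball x (2 ^- k) : set (measurableTypeR R)) by exact: measurable_ball.
have bE := lebesgue_measure_ball x (ltW r0).
have fin : (mu (A `&` ball x (2 ^- k)) \is a fin_num)%E.
  rewrite ge0_fin_numE ?measure_ge0//; apply: (@le_lt_trans _ _ (mu (ball x (2 ^- k)))).
    by apply: le_measure; rewrite ?inE//; exact: measurableI.
  by rewrite bE ltry.
have sub : dyadic k i `<=` ball x (2 ^- k).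
  move=> y; rewrite /dyadic /= in_itv/= /ball/= => /andP[h1 h2].
  have /andP[h3 h4] := floor_itv (x * 2 ^+ k); rewrite -/i in h3 h4.
  rewrite intrD in h2 h4; set t := 2 ^+ k in h1 h2 h3 h4 *.
  have t0 : 0 < t by rewrite exprn_gt0.
  rewrite ler_pdivrMr// in h1; rewrite ltr_pdivlMr// in h2.
  rewrite -[t^-1]mul1r ltr_pdivlMr// -(gtr0_norm t0) -normrM mulrBl ltr_norml; lra.
apply: (@le_trans _ _ (mu (ball x (2 ^- k) `\` A))).
  apply: le_measure; rewrite ?inE; [| |exact: setSD].
    by apply: measurableD => //; exact: measurable_dyadic.
  exact: measurableD.
have DI := measureDI mu mb mA.
have iE : ball x (2 ^- k) `&` A = A `&` ball x (2 ^- k) by rewrite setIC.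
have DI' : ((2 ^- k *+ 2)%:E = mu (ball x (2 ^- k) `\` A) + mu (A `&` ball x (2 ^- k)))%E.
  by rewrite -bE -iE; exact: DI.
rewrite bE in hd; move: hd DI'.
rewrite -(fineK fin); set v := fine _.
have -> : ((2 ^- k *+ 2)%:E^-1 = (2 ^- k *+ 2)^-1%:E :> \bar R)%E.
  by rewrite inver gt_eqF// mulrn_wgt0.
rewrite -EFinM lte_fin ltr_pdivlMr ?mulrn_wgt0// => hd.
case: (mu _) => [w||]//.
rewrite -EFinD => -[] hw; rewrite lee_fin.
by move: hd hw; rewrite -[2 ^- k *+ 2]mulr_natl; set z := 2 ^- k; lra.
Qed.

End LebesgueAffine.

(** * Zero-one laws by doubling and by dyadic translations *)

Section ZeroOne.
Context {R : realType}.
Local Notation mu := (@lebesgue_measure R).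
Local Notation meas A := (measurable (A : set (measurableTypeR R))).
Implicit Types (A D : set R) (x y c r : R).

Let unit_itv : set R := `[0, 1[%classic.
Let munit : meas unit_itv. Proof. exact: measurable_itv. Qed.

Definition periodic A := forall x, A (x + 1) <-> A x.

Lemma periodicD A (n : nat) x : periodic A -> A (x + n%:R) <-> A x.
Proof.
move=> pA; elim: n x => [|n IH] x; first by rewrite addr0.
by rewrite -natr1 addrA pA IH.
Qed.

Lemma le_mu (A D : set R) : meas A -> meas D -> A `<=` D -> (mu A <= mu D)%E.
Proof. by move=> mA mD AD; apply: le_measure; rewrite ?inE. Qed.

Lemma conull_of_unit A : meas A -> periodic A -> mu (unit_itv `\` A) = 0%E -> mu (~` A) = 0%E.
Proof.
move=> mA pA h0; have mZ : meas (unit_itv `\` A) by exact: measurableD.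
have nZ b : mu.-negligible ((fun x => x + b) @^-1` (unit_itv `\` A)).
  apply/negligibleP.
    rewrite (_ : (fun x => x + b) = (fun x => 1 * x + b)).
      exact: measurable_preimage_affine.
    by apply/funext => x; rewrite mul1r.
  exact: etrans (lebesgue_preimage_shift b mZ) h0.
have nU : mu.-negligible (\bigcup_(n : nat) ((fun x => x + n%:R) @^-1` (unit_itv `\` A)
   `|` (fun x => x - n%:R) @^-1` (unit_itv `\` A))).
  by apply: negligible_bigcup => n; apply: negligibleU.
apply: measure_negligible; first exact: measurableC.
apply: negligibleS nU.
move=> x nAx; have /andP[h1 h2] := floor_itv x; rewrite intrD in h2.
case: (intP (Num.floor x)) h1 h2 => [|n|n] h1 h2.
- exists 0%N => //; left => /=; split; rewrite addr0//.
  by rewrite /unit_itv /= in_itv/= h1; lra.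
- exists n.+1 => //; right => /=; split.
    by rewrite /unit_itv /= in_itv/=; move: h1 h2; rewrite -pmulrn => h1 h2; lra.
  by move=> h; apply: nAx; rewrite -(subrK n.+1%:R x) periodicD.
- exists n.+1 => //; left => /=; split; last by rewrite periodicD.
  by rewrite /unit_itv /= in_itv/=; move: h1 h2; rewrite mulrNz -pmulrn => h1 h2; lra.
Qed.

(** Common end of both zero-one laws: a cell with defect at most e 2^-k exists for every e, and the
    last hypothesis turns this into defect at most e on a whole period. *)
Lemma conull_of_dyadic A : meas A -> periodic A -> mu A <> 0%E ->
  (forall k i, (mu (unit_itv `\` A) <= (2 ^+ k)%:E * mu (dyadic k i `\` A))%E) ->
  mu (~` A) = 0%E.
Proof.
move=> mA pA A0 h; apply: conull_of_unit => //.
apply/eqP; rewrite eq_le measure_ge0 andbT; apply/lee_addgt0Pr => e e0; rewrite add0e.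
have [k [i hki]] := exists_dense_dyadic mA A0 e0.
apply: (le_trans (h k i)); apply: (@le_trans _ _ ((2 ^+ k)%:E * (e / 2 ^+ k)%:E)%E).
  by rewrite lee_pmul2l// lte_fin exprn_gt0.
by rewrite -EFinM mulrC divfK// expf_neq0.
Qed.

(* Doubling spreads a dyadic interval nearly filled by [A] over a whole period. *)
Lemma doubling_conull A : meas A -> periodic A -> (forall x, A x -> A (2 * x)) ->
  mu A <> 0%E -> mu (~` A) = 0%E.
Proof.
move=> mA pA dA A0; apply: conull_of_dyadic => // k i.
have md l j : meas (dyadic l j `\` A).
  by apply: measurableD => //; exact: measurable_dyadic.
have step l : (mu (dyadic l i `\` A) <= 2%:E * mu (dyadic l.+1 i `\` A))%E.
  rewrite -(@lebesgue_preimage_affine R 2 0 (dyadic l i `\` A))// lee_pmul2l//.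
  apply: le_mu => //; first exact: measurable_preimage_affine.
  move=> x /= []; rewrite addr0 /dyadic/= !in_itv/= => h nA; split; last first.
    by move=> Ax; apply: nA; exact: dA.
  by move: h; rewrite exprSr invfM !mulrA; lra.
have chain l : (mu (dyadic 0 i `\` A) <= (2 ^+ l)%:E * mu (dyadic l i `\` A))%E.
  elim: l => [|l IH]; first by rewrite expr0 mul1e.
  apply: (le_trans IH); rewrite exprSr EFinM -muleA lee_pmul2l// lte_fin exprn_gt0//.
apply: le_trans (chain k).
have E : (unit_itv `\` A) = (fun x => x + i%:~R) @^-1` (dyadic 0 i `\` A).
  have pi x : A (x + i%:~R) <-> A x.
    case: (intP i) => [|n|n]; first by rewrite addr0.
      by rewrite -pmulrn periodicD.
    by rewrite mulrNz -pmulrn -{2}(subrK n.+1%:R x) periodicD.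
  apply/seteqP; split => x /= []; rewrite /unit_itv /dyadic /= !in_itv/= expr0 !divr1 intrD => h nA.
    by split; [lra|rewrite pi].
  by split; [lra|rewrite -pi].
by rewrite E lebesgue_preimage_shift.
Qed.

(** Translation by [c] moves the fixed point -c of x |-> 2 x + c to 0 and reduces to pure
    doubling. *)
Lemma affine_doubling_conull A c : meas A -> periodic A ->
  (forall x, A x -> A (2 * x + c)) -> mu A <> 0%E -> mu (~` A) = 0%E.
Proof.
move=> mA pA dA A0.
have -> : mu (~` A) = mu (~` ((fun x => x - c) @^-1` A)).
  by rewrite -(lebesgue_preimage_shift (- c))//; exact: measurableC.
apply: doubling_conull.
- rewrite (_ : (fun x => x - c) = (fun x => 1 * x - c)).
    exact: measurable_preimage_affine.
  by apply/funext => x; rewrite mul1r.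
- by move=> x /=; rewrite addrAC pA.
- by move=> x /= /dA; rewrite (_ : 2 * (x - c) + c = 2 * x - c)//; ring.
- by rewrite lebesgue_preimage_shift.
Qed.

(** Invariance of [D] under multiples of 2^-k makes all cells of one level up to k have the same
    defect, so a period has at most 2^k times the defect of one cell of level k. The set [D] may
    vary with k, since only the part of [A] from denominators of high 2-adic valuation is exactly
    invariant. *)
Lemma translation_conull A : meas A -> periodic A ->
  (forall k : nat, exists D, [/\ meas D, D `<=` A, mu (A `\` D) = 0%E &
     forall x (i : int), D x -> D (x + i%:~R / 2 ^+ k)]) ->
  mu A <> 0%E -> mu (~` A) = 0%E.
Proof.
move=> mA pA hD A0; apply: conull_of_dyadic => // k i.
have [D [mD DA AD0 tD]] := hD k.
have md l j : meas (dyadic l j `\` D).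
  by apply: measurableD => //; exact: measurable_dyadic.
have tr l (j : int) : (l <= k)%N -> mu (dyadic l j `\` D) = mu (dyadic l 0 `\` D).
  move=> lk; have cE : j%:~R / 2 ^+ l = (j * 2 ^+ (k - l))%:~R / 2 ^+ k :> R.
    rewrite intrM rmorphXn/= -{2}(subnK lk) exprD; field.
    by rewrite !expf_neq0.
  have E : (dyadic l 0 `\` D) = (fun x => x + j%:~R / 2 ^+ l) @^-1` (dyadic l j `\` D).
    have pj x : D (x + j%:~R / 2 ^+ l) <-> D x.
      rewrite cE; split => [h|]; last exact: tD.
      by rewrite -(addrK ((j * 2 ^+ (k - l))%:~R / 2 ^+ k) x) -mulNr -mulrNz; apply: tD.
    have s0 : 0 < 2 ^+ l :> R by rewrite exprn_gt0.
    apply/seteqP; split => x /= []; rewrite /dyadic /= !in_itv/= !intrD !mulrDl => h nA.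
      by split; [lra|rewrite pj].
    by split; [lra|rewrite -pj].
  by rewrite E lebesgue_preimage_shift.
have step l : (l < k)%N -> (mu (dyadic l 0 `\` D) <= 2%:E * mu (dyadic l.+1 0 `\` D))%E.
  move=> lk; apply: (@le_trans _ _ (mu ((dyadic l.+1 0 `\` D) `|` (dyadic l.+1 1 `\` D)))).
    apply: le_mu => //; first exact: measurableU.
    move=> x /= []; rewrite /dyadic/= !in_itv/= !exprS !invfM => h nA.
    have s0 : 0 < 2 ^+ l :> R by rewrite exprn_gt0.
    have [x1|x1] := ltP x ((0 + 1)%:~R * (2^-1 / 2 ^+ l)); [left|right]; split=> //.
      by rewrite andbT; move: h; rewrite !mul0r => /andP[].
    by rewrite /=; move: h; rewrite !intrD; lra.
  apply: (le_trans (measureU2 _ _ _)) => //.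
  rewrite -[2]/(1 + 1) EFinD ge0_muleDl// mul1e.
  by apply: leeD; [exact: lexx|rewrite -(tr l.+1 1)//; exact: lexx].
have chain l : (l <= k)%N -> (mu (dyadic 0 0 `\` D) <= (2 ^+ l)%:E * mu (dyadic l 0 `\` D))%E.
  elim: l => [|l IH] lk; first by rewrite expr0 mul1e.
  apply: (le_trans (IH (ltnW lk))); rewrite exprSr EFinM -muleA lee_pmul2l// ?lte_fin ?exprn_gt0//.
  exact: step.
apply: (@le_trans _ _ (mu (dyadic 0 0 `\` D))).
  apply: le_mu => //; first exact: measurableD.
  move=> x /= []; rewrite /unit_itv /dyadic/= !in_itv/= expr0 !divr1 => h nA.
  by split=> //; move=> /DA.
apply: (le_trans (chain k (leqnn k))); rewrite lee_pmul2l ?lte_fin ?exprn_gt0//.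
rewrite -(tr k i)//; apply: (@le_trans _ _ (mu ((dyadic k i `\` A) `|` (A `\` D)))).
  apply: le_mu => //.
    apply: measurableU; first by apply: measurableD => //; exact: measurable_dyadic.
    exact: measurableD.
  by move=> x /= [h nD]; have [Ax|nAx] := pselect (A x); [right|left].
have h0 : (mu (A `\` D) <= 0)%E by rewrite AD0.
apply: (le_trans (measureU2 _ _ _)).
- by apply: measurableD => //; exact: measurable_dyadic.
- exact: measurableD.
- by rewrite -[leRHS]adde0; apply: leeD; [exact: lexx|exact: h0].
Qed.

Definition approx (n : nat) r : set R :=
  [set x | exists2 a : int, coprimez a n & `|x - a%:~R / n%:R| < r].

Lemma measurable_approx n r : meas (approx n r).
Proof.
apply: open_measurable.
have -> : approx n r = \bigcup_(a in [set a : int | coprimez a n]) ball (a%:~R / n%:R : R) r.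
  apply/seteqP; split => x [a ca h]; exists a => //; move: h; by rewrite /ball/= distrC.
by apply: bigcup_open => a _; exact: ball_open.
Qed.

(** As 1/d = w/n, the numerator becomes a + i w, which stays coprime to [w]; the hypothesis on [w]
    and [d] passes this on to [d]. *)
Lemma approx_shift n w d r x (i : int) : (0 < n)%N -> (n = w * d)%N ->
  (forall a, coprimez a w -> coprimez a d) ->
  approx n r x -> approx n r (x + i%:~R / d%:R).
Proof.
move=> n0 nE wd [a an h]; exists (a + i * w).
  have : coprimez (a + i * w) w.
    rewrite coprimez_sym /coprimez addrC gcdzMDl -/(coprimez _ _) coprimez_sym.
    by move: an; rewrite nE PoszM coprimezMr => /andP[].
  by move=> hw; rewrite nE PoszM coprimezMr hw wd.
have w0 : w%:R != 0 :> R by rewrite pnatr_eq0; move: n0; rewrite nE muln_gt0 -lt0n => /andP[].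
have d0 : d%:R != 0 :> R by rewrite pnatr_eq0; move: n0; rewrite nE muln_gt0 -lt0n => /andP[].
suff -> : x + i%:~R / d%:R - (a + i * w)%:~R / n%:R = x - a%:~R / n%:R by [].
rewrite intrD intrM nE natrM -[w%:~R]pmulrn; field; by rewrite w0 d0.
Qed.

(* Writing [n = 2^v * w] with [w] odd, the numerator [a] is sent to [2 a + w], which
   is odd and coprime to [w]. *)
Lemma approx_double n r x : (0 < n)%N ->
  approx n r x -> approx n (2 * r) (2 * x + (2 ^ logn 2 n)%:R^-1).
Proof.
move=> n0 [a an h]; set v := logn 2 n; set w := (n %/ 2 ^ v)%N.
have nE : n = (w * 2 ^ v)%N by rewrite divnK// pfactor_dvdn.
have w0 : (0 < w)%N by move: n0; rewrite nE muln_gt0 => /andP[].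
have cw : coprimez 2 w.
  rewrite coprimezE /= prime_coprime//; apply/negP => h2.
  have : (2 ^ v.+1 %| n)%N by rewrite nE expnSr mulnC dvdn_mul.
  by rewrite pfactor_dvdn// ltnn.
exists (2 * a + w).
  rewrite nE PoszM coprimezMr; apply/andP; split.
    rewrite coprimez_sym /coprimez -[X in gcdz _ (_ + X)]mul1r addrC gcdzMDl.
    rewrite -/(coprimez _ _) coprimez_sym.
    by rewrite coprimezMl cw /=; move: an; rewrite nE PoszM coprimezMr => /andP[].
  rewrite (_ : (2 ^ v)%N = 2%:Z ^+ v :> int); last by rewrite -[LHS]natz natrX.
  apply: coprimezXr; rewrite coprimez_sym /coprimez mulrC gcdzMDl -/(coprimez _ _) //.
have w0' : w%:R != 0 :> R by rewrite pnatr_eq0 -lt0n.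
have d0 : (2 ^ v)%:R != 0 :> R by rewrite pnatr_eq0 expn_eq0.
have -> : 2 * x + (2 ^ v)%:R^-1 - (2 * a + w)%:~R / n%:R = 2 * (x - a%:~R / n%:R).
  rewrite intrD intrM [in LHS]nE [in RHS]nE natrM -[w%:~R]pmulrn; field; by rewrite w0' d0.
by rewrite normrM ger0_norm// ltr_pM2l.
Qed.

Section LimsupApprox.
Variables (B : nat -> nat -> Prop) (delta : nat -> nat -> R).
Hypothesis B_gt0 : forall h n, B h n -> (0 < n)%N.

Definition hits (Q : pred nat) (j : nat) : set R :=
  [set x | forall H : nat, exists2 h : nat, (H <= h)%N &
    exists n, [/\ B h n, Q n & approx n (2 ^+ j * delta h n) x]].

(** The union over [j] absorbs the doubling of the radii under x |-> 2 x + c, so that a stable set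
    results. *)
Definition all_hits Q : set R := \bigcup_j hits Q j.

Lemma measurable_all_hits Q : meas (all_hits Q).
Proof.
apply: bigcup_measurable => j _.
have -> : hits Q j = \bigcap_H \bigcup_(h in [set h | (H <= h)%N])
    \bigcup_(n in [set n | B h n /\ Q n]) approx n (2 ^+ j * delta h n).
  apply/seteqP; split => x.
    move=> hx H _; have [h Hh [n [Bn Qn ax]]] := hx H.
    by exists h => //; exists n.
  move=> hx H; have [h Hh [n [Bn Qn] ax]] := hx H I.
  by exists h => //; exists n.
apply: bigcap_measurable; first by exists 0%N.
move=> H _; apply: bigcup_measurable => h _; apply: bigcup_measurable => n _.
exact: measurable_approx.
Qed.

Lemma all_hits_periodic Q : periodic (all_hits Q).
Proof.
have s (i : int) x : all_hits Q x -> all_hits Q (x + i%:~R).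
  move=> [j _ hx]; exists j => // H; have [h Hh [n [Bn Qn ax]]] := hx H.
  exists h => //; exists n; split=> //.
  have -> : i%:~R = i%:~R / 1%:R :> R by rewrite divr1.
  apply: (@approx_shift n n) => //; first exact: B_gt0 Bn.
    by rewrite muln1.
  by move=> a _; rewrite coprimezE coprimen1.
move=> x; split; last exact: (s 1).
by move/(s (-1)); rewrite rmorphN/= addrK.
Qed.

Let val2 v : pred nat := fun n => logn 2 n == v.
Let val2_gt v : pred nat := fun n => (v < logn 2 n)%N.

Lemma all_hits_val2_double v x :
  all_hits (val2 v) x -> all_hits (val2 v) (2 * x + (2 ^ v)%:R^-1).
Proof.
move=> [j _ hx]; exists j.+1 => // H; have [h Hh [n [Bn /eqP Qn ax]]] := hx H.
exists h => //; exists n; split=> //; first by rewrite /val2 Qn.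
by rewrite exprS -mulrA -Qn; apply: approx_double => //; exact: B_gt0 Bn.
Qed.

(** Valuation strictly above k keeps n / 2^k even, so a numerator coprime to n / 2^k is
    automatically odd; this is what [approx_shift] asks for. *)
Lemma all_hits_val2_gt_shift k x (i : int) :
  all_hits (val2_gt k) x -> all_hits (val2_gt k) (x + i%:~R / 2 ^+ k).
Proof.
move=> [j _ hx]; exists j => // H; have [h Hh [n [Bn Qn ax]]] := hx H.
exists h => //; exists n; split=> //; have n0 := B_gt0 Bn.
have -> : 2 ^+ k = (2 ^ k)%:R :> R by rewrite natrX.
have d : (2 ^ k.+1 %| n)%N by rewrite pfactor_dvdn.
apply: (@approx_shift n (n %/ 2 ^ k)) => //.
  by rewrite divnK// (dvdn_trans _ d)// dvdn_exp2l.
move=> a; case: k {Qn hx} d => [|k] d; first by move=> _; rewrite expn0 coprimezE /= coprimen1.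
rewrite !coprimezE /= coprime_pexpr// => c.
apply: coprime_dvdr c; rewrite dvdn_divRL; first by rewrite -expnS.
by rewrite (dvdn_trans _ d)// dvdn_exp2l.
Qed.

(** Pigeonhole: if large valuations and each of the finitely many v <= k hit only up to some index,
    there is no hit beyond the largest of these indices. *)
Lemma all_hits_split k x : all_hits xpredT x ->
  all_hits (val2_gt k) x \/ exists2 v, (v <= k)%N & all_hits (val2 v) x.
Proof.
move=> [j _ hx]; apply: contrapT => /not_orP[ng nv].
have [H0 hH0] : exists H0, forall h n, (H0 <= h)%N -> B h n ->
    approx n (2 ^+ j * delta h n) x -> (logn 2 n <= k)%N.
  apply: contrapT => /forallNP hH; apply: ng; exists j => // H.
  have /existsNP[h /existsNP[n /not_implyP[Hh /not_implyP[Bn /not_implyP[ax /negP nl]]]]] := hH H.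
  by exists h => //; exists n; split => //; rewrite /val2_gt ltnNge.
have hv v : exists Hv, (v <= k)%N -> forall h n, (Hv <= h)%N -> B h n ->
    approx n (2 ^+ j * delta h n) x -> logn 2 n != v.
  have [vk|vk] := leqP v k; last by exists 0%N.
  apply: contrapT => /forallNP hH; apply: nv; exists v => //; exists j => // H.
  have /not_implyP[_ /existsNP[h /existsNP[n]]] := hH H.
  move=> /not_implyP[Hh /not_implyP[Bn /not_implyP[ax /negP/negPn nl]]].
  by exists h => //; exists n.
have [f hf] := choice hv.
have [h Hh [n [Bn _ ax]]] := hx (maxn H0 (\max_(v < k.+1) f v)).
have nk : (logn 2 n <= k)%N.
  by apply: (hH0 h) => //; apply: leq_trans Hh; exact: leq_maxl.
have := hf (logn 2 n) nk h n; rewrite eqxx => /(_ _ Bn ax)/negP; apply => //.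
apply: leq_trans Hh; apply: leq_trans (leq_maxr _ _).
have nk1 : (logn 2 n < k.+1)%N by rewrite ltnS.
exact: (@leq_bigmax _ (fun v : 'I_k.+1 => f v) (Ordinal nk1)).
Qed.

Lemma all_hits_zero_one : mu (all_hits xpredT) <> 0%E -> mu (~` all_hits xpredT) = 0%E.
Proof.
move=> A0; have mT := measurable_all_hits.
have subT Q : all_hits Q `<=` all_hits xpredT.
  move=> x [j _ hx]; exists j => // H; have [h Hh [n [Bn Qn ax]]] := hx H.
  by exists h => //; exists n.
have [[v hv]|hv] := pselect (exists v, mu (all_hits (val2 v)) <> 0%E).
  have := affine_doubling_conull (mT _) (@all_hits_periodic (val2 v)) (@all_hits_val2_double v) hv.
  move=> h; apply/eqP; rewrite eq_le measure_ge0 andbT -h.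
  by apply: le_mu; [exact: measurableC|exact: measurableC|exact: subsetC].
apply: translation_conull => //; first exact: all_hits_periodic.
move=> k; exists (all_hits (val2_gt k)); split=> //; last exact: all_hits_val2_gt_shift.
have nU : mu.-negligible (\bigcup_v all_hits (val2 v)).
  apply: negligible_bigcup => v; apply/negligibleP => //.
  by apply: contrapT => h; apply: hv; exists v.
apply: measure_negligible; first exact: measurableD.
apply: negligibleS nU => x [hx nx]; have [//|[v _ hxv]] := all_hits_split k hx.
by exists v.
Qed.

End LimsupApprox.
End ZeroOne.

(** * A weighted second moment bound for unions *)

Section SecondMoment.
Context {R : realType}.
Local Notation mu := (@lebesgue_measure R).
Local Notation meas A := (measurable (A : set (measurableTypeR R))).

Lemma integral_sum_indic (I : eqType) (s : seq I) (A : I -> set R) (c : I -> R) :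
  (forall i, 0 <= c i) -> (forall i, meas (A i)) ->
  (\int[mu]_x (\sum_(i <- s) c i * \1_(A i) x)%:E = \sum_(i <- s) (c i)%:E * mu (A i))%E.
Proof.
move=> c0 mA.
transitivity (\int[mu]_x (\sum_(i <- s) ((c i)%:E * (\1_(A i) x)%:E))%E)%E.
  by apply: eq_integral => x _; rewrite -sumEFin; under eq_bigr do rewrite EFinM.
have mi i : measurable_fun [set: measurableTypeR R] (fun x => (\1_(A i) x)%:E : \bar R).
  by apply/measurable_EFinP; exact: measurable_indic.
rewrite ge0_integral_sum//.
- apply: eq_bigr => i _; rewrite ge0_integralZl_EFin//.
    by rewrite integral_indic ?setIT.
- by move=> i; apply: emeasurable_funM => //; exact: measurable_cst.
- by move=> i x _; rewrite mule_ge0// lee_fin.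
Qed.

(** A linearised Cauchy-Schwarz inequality: the free parameter [t] replaces the optimisation, so no
    quotient of measures occurs and [U] may have infinite measure. *)
Lemma second_moment (I : eqType) (s : seq I) (A : I -> set R) (U : set R)
  (w m : I -> R) (q : I -> I -> R) (t : R) :
  0 < t -> (forall i, 0 <= w i) -> (forall i, meas (A i)) -> meas U ->
  (forall i, i \in s -> A i `<=` U) ->
  (forall i, mu (A i) = (m i)%:E) -> (forall i j, (mu (A i `&` A j) <= (q i j)%:E)%E) ->
  ((2 * \sum_(i <- s) w i * m i)%:E <=
    (t * \sum_(i <- s) \sum_(j <- s) w i * w j * q i j)%:E + (t^-1)%:E * mu U)%E.
Proof.
move=> t0 w0 mA mU AU mE qE.
pose f x := \sum_(i <- s) w i * \1_(A i) x.
have f0 x : 0 <= f x by apply: sumr_ge0 => i _; rewrite mulr_ge0.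
have ff x : f x * f x = \sum_(p <- [seq (i, j) | i <- s, j <- s])
     (w p.1 * w p.2) * \1_(A p.1 `&` A p.2) x.
  rewrite big_allpairs /f mulr_suml; apply: eq_bigr => i _.
  rewrite mulr_sumr; apply: eq_bigr => j _ /=.
  by rewrite indicI mulrACA.
pose S2 := [seq (i, j) | i <- s, j <- s].
(* [None] indexes U and [Some (i, j)] the intersections, so the whole right-hand side is a single
   sum of indicators to integrate. *)
pose S3 : seq (option (I * I)) := None :: map some S2.
pose A3 o := if o is Some p then A p.1 `&` A p.2 else U.
pose c3 o := if o is Some p then t * (w p.1 * w p.2) else t^-1.
have c30 o : 0 <= c3 o by case: o => [p|] /=; rewrite ?mulr_ge0 ?invr_ge0// ltW.
have mA3 o : meas (A3 o) by case: o => [p|] //=; exact: measurableI.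
have le x : \sum_(i <- s) (2 * w i) * \1_(A i) x <= \sum_(o <- S3) c3 o * \1_(A3 o) x.
  have -> : \sum_(i <- s) (2 * w i) * \1_(A i) x = 2 * f x.
    by rewrite mulr_sumr; under [RHS]eq_bigr do rewrite mulrA.
  have -> : \sum_(o <- S3) c3 o * \1_(A3 o) x = t^-1 * \1_U x + t * (f x * f x).
    rewrite big_cons big_map ff mulr_sumr /=; congr (_ + _).
    by apply: eq_bigr => p _; rewrite -!mulrA.
  have [Ux|nUx] := pselect (U x).
    rewrite indicE mem_set// mulr1.
    (* On [U] we use [2 f <= t f^2 + 1 / t]. *)
    have : 0 <= t * (f x - t^-1) ^+ 2 by rewrite mulr_ge0 ?sqr_ge0// ltW.
    have -> : t * (f x - t^-1) ^+ 2 = t * (f x * f x) - 2 * f x + t^-1.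
      by field; rewrite gt_eqF.
    lra.
  have -> : f x = 0.
    rewrite /f big1_seq// => i /andP[_ si]; rewrite indicE memNset ?mulr0//.
    by move=> Ax; apply: nUx; exact: AU Ax.
  by rewrite !mulr0 addr0 mulr_ge0// invr_ge0 ltW.
have mf (J : eqType) (s' : seq J) (B : J -> set R) (c : J -> R) : (forall i, meas (B i)) ->
    measurable_fun [set: measurableTypeR R] (fun x => (\sum_(i <- s') c i * \1_(B i) x)%:E).
  move=> mB; apply/measurable_EFinP; apply: measurable_sum => i.
  by apply: measurable_funM; [exact: measurable_cst|exact: measurable_indic].
have hint : (\int[mu]_x (\sum_(i <- s) (2 * w i) * \1_(A i) x)%:E <=
    \int[mu]_x (\sum_(o <- S3) c3 o * \1_(A3 o) x)%:E)%E.
  apply: ge0_le_integral => //; try exact: mf.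
  - by move=> x _; rewrite lee_fin sumr_ge0// => i _; rewrite !mulr_ge0.
  - by move=> x _; rewrite lee_fin.
rewrite !integral_sum_indic// in hint; last by move=> i; rewrite mulr_ge0.
have e1 : (\sum_(i <- s) (2 * w i)%:E * mu (A i) = (2 * \sum_(i <- s) w i * m i)%:E)%E.
  rewrite mulr_sumr -sumEFin; apply: eq_bigr => i _.
  by rewrite mE -EFinM mulrA.
rewrite e1 in hint; apply: (le_trans hint).
rewrite big_cons big_map addeC; apply: leeD => //=.
rewrite mulr_sumr -sumEFin big_allpairs; apply: lee_sum => i _.
rewrite mulr_sumr -sumEFin; apply: lee_sum => j _ /=.
apply: (@le_trans _ _ ((t * (w i * w j))%:E * (q i j)%:E)%E); last by rewrite -EFinM -!mulrA.
by apply: lee_wpmul2l; [rewrite lee_fin !mulr_ge0// ltW|exact: qE].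
Qed.

Lemma lebesgue_ballI (c d r s : R) : 0 <= r -> 0 <= s ->
  (mu (ball c r `&` ball d s) <= (2 * Num.min r s * (`|c - d| < r + s)%R%:R)%:E)%E.
Proof.
move=> r0 s0; have mb (e u : R) : meas (ball e u) by exact: measurable_ball.
have [lt|ge] := ltP `|c - d| (r + s); last first.
  rewrite mulr0 (_ : _ `&` _ = set0) ?measure0//.
  apply/seteqP; split => // x [/=]; rewrite /ball/= => h1 h2.
  have : `|c - d| <= `|c - x| + `|d - x|.
    by rewrite (distrC d) (le_trans _ (ler_normD _ _))// subrKA.
  lra.
rewrite mulr1; case: (leP r s) => _.
  apply: (@le_trans _ _ (mu (ball c r))).
    by apply: le_mu => //; exact: measurableI.
  by rewrite lebesgue_measure_ball// mulr_natl.
apply: (@le_trans _ _ (mu (ball d s))).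
  by apply: le_mu => //; exact: measurableI.
by rewrite lebesgue_measure_ball// mulr_natl.
Qed.

End SecondMoment.

(** * Choosing the dilation of a block *)

Section Block.
Context {R : realType}.
Implicit Types (h n m k K T : nat).

Lemma harmonic_le K : \sum_(1 <= j < K.+1) j%:R^-1 <= 1 + ln K%:R :> R.
Proof.
case: K => [|K]; first by rewrite big_geq// ln0// addr0.
elim: K => [|K IH]; first by rewrite big_nat1 invr1 ln1 addr0.
rewrite big_nat_recr//= (le_trans (lerD IH (lexx _)))//.
have K1 : 0 < K.+1%:R :> R by rewrite ltr0n.
have K2 : 0 < K.+2%:R :> R by rewrite ltr0n.
have := @le_ln1Dx R (K.+1%:R / K.+2%:R - 1).
rewrite (_ : 1 + (K.+1%:R / K.+2%:R - 1) = K.+1%:R / K.+2%:R); last by ring.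
rewrite ltrBrDr addNr divr_gt0// ln_div ?posrE// => /(_ isT).
have -> : K.+1%:R / K.+2%:R - 1 = - K.+2%:R^-1 :> R.
  have e : K.+2%:R = K.+1%:R + 1 :> R by rewrite natr1.
  by move: K2; rewrite e; move: (K.+1%:R) => z z0; field; rewrite gt_eqF.
move: (ln K.+1%:R) (ln K.+2%:R) (K.+2%:R^-1) => a b c; lra.
Qed.

(** Induction on [K]. A last term with condition false is dropped. If it is present, then Y >= 2^K,
    so the term k = 0 is at most 1 / (1 + K/2) <= 2 / (K + 1), and the others form the sum for
    Y/2. *)
Lemma sum_kappa_aux K (Y : R) :
  \sum_(0 <= k < K) (if 1 <= 2 ^- k * Y then (1 + ln (2 ^- k * Y))^-1 else 0) <=
  2 * \sum_(1 <= j < K.+1) j%:R^-1.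
Proof.
elim: K Y => [|K IH] Y; first by rewrite !big_geq// mulr0.
have F0 (k : nat) (Z : R) : 0 <= (if 1 <= 2 ^- k * Z then (1 + ln (2 ^- k * Z))^-1 else 0).
  by case: ifP => // h; rewrite invr_ge0 addr_ge0// ln_ge0.
have [last|last] := leP 1 (2 ^- K * Y); last first.
  rewrite big_nat_recr//= ifF ?addr0; last by apply/negbTE; rewrite -ltNge.
  rewrite (le_trans (IH Y))// [in leRHS]big_nat_recr//= mulrDr lerDl.
  by rewrite mulr_ge0 ?invr_ge0.
rewrite big_nat_recl// [in leRHS]big_nat_recr//= mulrDr addrC lerD//.
  apply: le_trans (IH (Y / 2)); apply: ler_sum => k _.
  by rewrite exprS invfM [2^-1 * _]mulrC -mulrA (mulrC 2^-1).
have s0 : 0 < 2 ^+ K :> R by rewrite exprn_gt0.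
have YK : 2 ^+ K <= Y by rewrite mulrC ler_pdivlMr// mul1r in last.
have Y1 : 1 <= Y by rewrite (le_trans _ YK)// exprn_ege1// ler1n.
rewrite expr0 invr1 mul1r Y1.
have l2 : 2^-1 <= ln 2 :> R.
  have := @le_ln1Dx R (2^-1 - 1); rewrite (_ : 1 + (2^-1 - 1) = 2^-1); last by ring.
  by rewrite lnV ?posrE// => /(_ ltac:(lra)); lra.
have lY : K%:R / 2 <= ln Y.
  apply: (@le_trans _ _ (ln (2 ^+ K))); last by rewrite ler_ln ?posrE//; lra.
  by rewrite lnXn// -[leRHS]mulr_natl ler_wpM2l.
have K0 : 0 <= K%:R :> R by [].
rewrite -[leRHS]invrK lef_pV2 ?posrE; last 2 first.
- lra.
- by rewrite invr_gt0 mulr_gt0// invr_gt0.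
rewrite invfM invrK -[K.+1%:R]natr1; lra.
Qed.

Lemma sum_kappa T K (Y : R) :
  \sum_(0 <= k < K) kappa T (2 ^- k * Y) <= K%:R + 2 * ln T%:R * (1 + ln K%:R).
Proof.
have lT := @ln_nat_ge0 R T.
apply: (@le_trans _ _ (\sum_(0 <= k < K) (1 + ln T%:R *
   (if 1 <= 2 ^- k * Y then (1 + ln (2 ^- k * Y))^-1 else 0)))).
  apply: ler_sum => k _; rewrite /kappa; case: ifP => // _.
  by rewrite mulr0 addr0.
rewrite big_split/= sumr_const_nat subn0 lerD2l -mulr_sumr.
have -> : 2 * ln T%:R * (1 + ln K%:R) = ln T%:R * (2 * (1 + ln K%:R)) :> R by ring.
rewrite ler_wpM2l// (le_trans (sum_kappa_aux _ _))//.
by rewrite ler_pM2l// harmonic_le.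
Qed.

Lemma exists_le_mean K (F : nat -> R) (M : R) : (0 < K)%N ->
  \sum_(0 <= k < K) F k <= K%:R * M -> exists2 k, (k < K)%N & F k <= M.
Proof.
move=> K0 hS; have [/hasP[k kK hk]|/hasPn hn] := boolP (has (fun k => F k <= M) (index_iota 0 K)).
  by exists k => //; move: kK; rewrite mem_index_iota.
exfalso; have : \sum_(0 <= k < K) M < \sum_(0 <= k < K) F k.
  apply: ltr_sum_nat => // k kK.
  by rewrite ltNge; apply: hn; rewrite mem_index_iota.
by rewrite sumr_const_nat subn0 -[M *+ K]mulr_natl ltNge hS.
Qed.

Definition block h := index_iota (2 ^ (2 ^ h)).+1 (2 ^ (2 ^ h.+1)).+1.

Lemma mem_block h n : (n \in block h) = (2 ^ (2 ^ h) < n <= 2 ^ (2 ^ h.+1))%N.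
Proof. by rewrite mem_index_iota ltnS. Qed.

(* Bounds the sum of the measures of the intersections of the balls of radius [r]
   around the [a / m] with those of radius [s] around the [b / n]. *)
Definition overlap m n (r s : R) := 2 * Num.min r s * overlap_count m n (r + s).

(** The bound of [sum_kappa] divided by [K]: it dominates the mean of [kappa] over K dilations,
    uniformly in Y. *)
Definition loss T K : R := 1 + 2 * ln T%:R * (1 + ln K%:R) / K%:R.

(** Apart from the scaling by 2^-2k, the dilation enters the quadratic part of [overlap_bound] only
    through [kappa], so a k not worse than the mean of [F] works for all pairs of the block
    together. The exponent h + 2 stems from m n <= (2^(2^(h+1)))^2. *)
Lemma block_choice : exists2 C : R, 0 < C & forall h K (r : nat -> R),
  (0 < K)%N -> (forall n, 0 <= r n) ->
  exists2 k, (k < K)%N &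
  \sum_(m <- block h) \sum_(n <- block h) overlap m n (2 ^- k * r m) (2 ^- k * r n) <=
  2 * (\sum_(n <- block h) 2 ^- k * r n * (totient n)%:R) +
  C * (\sum_(n <- block h) 2 ^- k * r n * (totient n)%:R) ^+ 2 * loss (2 ^ h.+2) K.
Proof.
have [C C0 hC] := @overlap_bound R; exists C => // h K r K0 r0.
set T := (2 ^ h.+2)%N.
have T1 : (1 < T)%N by rewrite /T -[X in (X < _)%N](expn0 2) ltn_exp2l.
pose Y m n := 2 * Num.max (r m) (r n) * m%:R * n%:R / (gcdn m n)%:R.
pose u n := r n * (totient n)%:R.
have u0 n : 0 <= u n by rewrite mulr_ge0.
pose S := \sum_(n <- block h) u n.
pose F k := \sum_(m <- block h) \sum_(n <- block h) u m * u n * kappa T (2 ^- k * Y m n).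
have K0' : 0 < K%:R :> R by rewrite ltr0n.
have [k kK hk] : exists2 k, (k < K)%N & F k <= S ^+ 2 * loss T K.
  apply: exists_le_mean => //.
  have -> : K%:R * (S ^+ 2 * loss T K) = S ^+ 2 * (K%:R + 2 * ln T%:R * (1 + ln K%:R)).
    by rewrite /loss; field; rewrite gt_eqF.
  rewrite /F exchange_big/= expr2 /S -mulrA mulr_suml; apply: ler_sum => m _.
  rewrite exchange_big/= mulr_suml mulr_sumr; apply: ler_sum => n _.
  by rewrite -mulr_sumr -mulrA ler_wpM2l// ler_wpM2l// sum_kappa.
exists k => //.
have s0 : 0 < 2 ^- k :> R by rewrite invr_gt0 exprn_gt0.
set c := 2 ^- k; have {}s0 : 0 < c by [].
have -> : \sum_(n <- block h) c * r n * (totient n)%:R = c * S.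
  by rewrite mulr_sumr; apply: eq_bigr => n _; rewrite mulrA.
apply: (@le_trans _ _ (\sum_(m <- block h) \sum_(n <- block h)
   ((m == n)%:R * (2 * (c * u m)) + C * (c ^+ 2 * (u m * u n * kappa T (c * Y m n)))))).
  rewrite big_seq [leRHS]big_seq; apply: ler_sum => m; rewrite mem_block => /andP[m1 m2].
  rewrite big_seq [leRHS]big_seq; apply: ler_sum => n; rewrite mem_block => /andP[n1 n2].
  have m0 : (0 < m)%N by apply: leq_ltn_trans m1.
  have n0 : (0 < n)%N by apply: leq_ltn_trans n1.
  have mnT : (m * n <= 2 ^ T)%N.
    by rewrite /T expnS mul2n -addnn expnD leq_mul.
  have cr (i : nat) : 0 <= c * r i by rewrite mulr_ge0// ltW.
  apply: (le_trans (hC T m n (c * r m) (c * r n) m0 n0 mnT T1 (cr m) (cr n))).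
  apply: lerD.
    by case: eqP => [->|_]; rewrite ?mul0r// !mul1r /u !mulrA.
  rewrite le_eqVlt; apply/orP; left; apply/eqP.
  have -> : 2 * Num.max (c * r m) (c * r n) * m%:R * n%:R / (gcdn m n)%:R = c * Y m n.
    by rewrite /Y -maxr_pMr ?ltW//; ring.
  by rewrite /u; ring.
have -> : \sum_(m <- block h) \sum_(n <- block h)
   ((m == n)%:R * (2 * (c * u m)) + C * (c ^+ 2 * (u m * u n * kappa T (c * Y m n)))) =
   2 * (c * S) + C * (c ^+ 2 * F k).
  under eq_bigr do rewrite big_split/=.
  rewrite big_split/=; congr (_ + _).
    rewrite /S mulr_sumr mulr_sumr big_seq [RHS]big_seq; apply: eq_bigr => m mb.
    rewrite -mulr_suml (eq_bigr (fun n => (n == m)%:R)); last by move=> n _; rewrite eq_sym.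
    rewrite sum_nat_eq; move: mb; rewrite mem_block ltnS => ->.
    by rewrite mul1r.
  rewrite /F; rewrite !mulr_sumr; apply: eq_bigr => m _; rewrite !mulr_sumr; by [].
rewrite lerD2l exprMn -!mulrA ler_pM2l// ler_pM2l ?exprn_gt0//.
by rewrite ler_pM2l// (le_trans hk)// expr2 mulrA.
Qed.

End Block.

(** * Divergent sums and the loss of a block *)

Section Series.
Context {R : realType}.
Implicit Types (f g : nat -> R) (N H h : nat).

Definition unbounded_sums f := forall M : R, exists N, M < \sum_(0 <= h < N) f h.

Lemma ler_sum_widen f N N' : (forall h, 0 <= f h) -> (N <= N')%N ->
  \sum_(0 <= h < N) f h <= \sum_(0 <= h < N') f h.
Proof.
by move=> f0 NN; rewrite [leRHS](big_cat_nat (n := N))//= lerDl sumr_ge0.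
Qed.

Lemma bounded_sums f : ~ unbounded_sums f -> exists M : R, forall N, \sum_(0 <= h < N) f h <= M.
Proof.
move=> /existsNP[M /forallNP hM]; exists M => N.
by rewrite leNgt; apply/negP => h; exact: (hM N).
Qed.

(** Allows keeping one residue class only, so that distinct remaining blocks are at least four
    apart. *)
Lemma unbounded_sums_class f : (forall h, 0 <= f h) -> unbounded_sums f ->
  exists c, unbounded_sums (fun h => if (h %% 4 == c)%N then f h else 0).
Proof.
move=> f0 uf; apply: contrapT => /forallNP hc.
have /choice[M hM] : forall c, exists M : R, forall N,
    \sum_(0 <= h < N) (if (h %% 4 == c)%N then f h else 0) <= M.
  by move=> c; apply: bounded_sums.
have [N] := uf (\sum_(0 <= c < 4) M c); rewrite ltNge => /negP; apply.
apply: (@le_trans _ _ (\sum_(0 <= c < 4)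
    \sum_(0 <= h < N) (if (h %% 4 == c)%N then f h else 0))); last first.
  by apply: ler_sum => c _; exact: hM.
rewrite exchange_big_nat/=; apply: ler_sum => h _.
rewrite -big_mkcond/= (eq_bigl (fun c => c == (h %% 4)%N)); last by move=> c; rewrite eq_sym.
by rewrite big_nat1_eq ltn_pmod.
Qed.

Lemma unbounded_sums_tail f h0 : (forall h, 0 <= f h) -> unbounded_sums f ->
  unbounded_sums (fun h => if (h0 <= h)%N then f h else 0).
Proof.
move=> f0 uf M; have [N hN] := uf (M + \sum_(0 <= h < h0) f h).
exists N; have hh : \sum_(0 <= h < N) f h <=
    \sum_(0 <= h < N) (if (h0 <= h)%N then f h else 0) + \sum_(0 <= h < h0) f h.
  apply: (@le_trans _ _ (\sum_(0 <= h < N) (if (h0 <= h)%N then f h else 0) +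
     \sum_(0 <= h < N) (if (h < h0)%N then f h else 0))).
    rewrite -big_split/=; apply: ler_sum => h _.
    by rewrite ltnNge; case: leqP; rewrite ?addr0 ?add0r.
  rewrite lerD2l -big_mkcond/= (big_nat_widen 0 h0 (maxn N h0)) ?leq_maxr//=.
  rewrite (big_nat_widen 0 N (maxn N h0)) ?leq_maxl//= big_mkcond [leRHS]big_mkcond/=.
  by apply: ler_sum => h _; case: (h < h0)%N => //=; case: ifP.
lra.
Qed.

(** Either f > 1 infinitely often, where the ratio is at least 1 / (1 + C), or f <= 1 eventually,
    where it is at least f / (1 + C). *)
Lemma unbounded_sums_ratio f (C : R) : 0 < C -> (forall h, 0 <= f h) -> unbounded_sums f ->
  unbounded_sums (fun h => f h / (f h + C)).
Proof.
move=> C0 f0 uf; apply: contrapT => /bounded_sums[M hM].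
pose g h := f h / (f h + C).
have g0 h : 0 <= g h by rewrite divr_ge0// addr_ge0// ltW.
have [N0 hN0] : exists N0, forall h, (N0 <= h)%N -> f h <= 1.
  apply: contrapT => /forallNP hN.
  have unb k : exists N, k%:R / (1 + C) <= \sum_(0 <= h < N) g h.
    elim: k => [|k [N IH]]; first by exists 0%N; rewrite big_geq// mul0r.
    have /existsNP[h /not_implyP[Nh /negP]] := hN N.
    rewrite -ltNge => fh; exists h.+1; rewrite big_nat_recr//= -natr1 mulrDl lerD//.
      exact: (le_trans IH (ler_sum_widen g0 Nh)).
    rewrite mul1r /g ler_pdivlMr ?addr_gt0//; last by apply: lt_trans fh.
    rewrite mulrC ler_pdivrMr ?addr_gt0//; nra.
  have [k hk] : exists k : nat, M * (1 + C) < k%:R.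
    by exists (Num.bound `|M * (1 + C)|); rewrite (le_lt_trans (ler_norm _))// archi_boundP.
  have [N] := unb k; rewrite ler_pdivrMr ?addr_gt0// => h2.
  have C1 : 0 < 1 + C by rewrite addr_gt0.
  by have := hM N; rewrite -/(g _) -(ler_pM2r C1); rewrite leNgt (lt_le_trans hk).
have [N hN] := uf (\sum_(0 <= h < N0) f h + (1 + C) * M).
have : \sum_(0 <= h < N) f h <= \sum_(0 <= h < N0) f h + (1 + C) * \sum_(0 <= h < N) g h.
  have [NN|NN] := leqP N N0.
    rewrite (le_trans (ler_sum_widen f0 NN))// lerDl mulr_ge0 ?addr_ge0 ?sumr_ge0//; lra.
  rewrite (big_cat_nat (n := N0) (leq0n _) (ltnW NN))//= lerD2l.
  apply: (@le_trans _ _ ((1 + C) * \sum_(N0 <= i < N) g i)).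
    rewrite mulr_sumr; apply: ler_sum_nat => h /andP[h1 _].
    have fh := hN0 h h1; have f0h := f0 h; rewrite /g mulrA ler_pdivlMr ?ltr_wpDl//.
    nra.
  rewrite ler_wpM2l//; first by lra.
  by rewrite [leRHS](big_cat_nat (n := N0) (leq0n _) (ltnW NN))//= lerDr sumr_ge0.
have C1 : 0 < 1 + C by rewrite addr_gt0.
have : (1 + C) * \sum_(0 <= h < N) g h <= (1 + C) * M by rewrite ler_pM2l//; exact: hM.
lra.
Qed.

Definition abel_dini g h : R := (1 + \sum_(0 <= i < h.+1) g i)^-1.

Lemma abel_dini_gt0 g h : (forall h, 0 <= g h) -> 0 < abel_dini g h.
Proof. by move=> g0; rewrite invr_gt0 ltr_pwDl// sumr_ge0. Qed.

Lemma abel_dini_le1 g h : (forall h, 0 <= g h) -> abel_dini g h <= 1.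
Proof. by move=> g0; rewrite invf_le1 ?lerDl ?ltr_pwDl// sumr_ge0. Qed.

(** With s the partial sums, choose N with s N > 2 s H + 1. All factors up to N are at least 1 / (1
    + s N), so the sum is at least (s N - s H) / (1 + s N) >= 1/2. *)
Lemma abel_dini_tail g H : (forall h, 0 <= g h) -> unbounded_sums g ->
  exists2 N, (H <= N)%N & 2^-1 <= \sum_(H <= h < N) abel_dini g h * g h.
Proof.
move=> g0 ug; pose s N := \sum_(0 <= h < N) g h.
have s0 N : 0 <= s N by apply: sumr_ge0.
have [N0 hN0] := ug (2 * s H + 1).
pose N := maxn N0 H; have hN : 2 * s H + 1 < s N.
  by apply: (lt_le_trans hN0); apply: ler_sum_widen => //; exact: leq_maxl.
have HN : (H <= N)%N by exact: leq_maxr.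
exists N => //.
have dN : 0 < 1 + s N by rewrite ltr_pwDl.
apply: (@le_trans _ _ ((s N - s H) / (1 + s N))).
  by rewrite ler_pdivlMr//; lra.
have -> : s N - s H = \sum_(H <= h < N) g h.
  by rewrite /s (big_cat_nat (n := H) (leq0n _) HN)//= addrAC subrr add0r.
rewrite mulr_suml; apply: ler_sum_nat => h /andP[_ hN'].
rewrite mulrC ler_wpM2r// lef_pV2 ?posrE ?ltr_pwDl ?sumr_ge0//.
by rewrite lerD2l; apply: ler_sum_widen.
Qed.

Lemma abel_dini_small g (e : R) : (forall h, 0 <= g h) -> unbounded_sums g -> 0 < e ->
  exists H, forall h, (H <= h)%N -> abel_dini g h <= e.
Proof.
move=> g0 ug e0; have [N hN] := ug e^-1; exists N => h Nh.
rewrite -[leRHS]invrK lef_pV2 ?posrE ?invr_gt0 ?ltr_pwDl ?sumr_ge0//.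
rewrite (le_trans (ltW hN))// (le_trans (ler_sum_widen g0 (leq_trans Nh (leqnSn h))))//.
by rewrite lerDr.
Qed.

(** Prevents the factors from shrinking too fast; needed for the lower bound on the radii in the
    comparison of different blocks. *)
Lemma abel_dini_ge g h : (forall h, 0 <= g h <= 1) -> (h.+2%:R)^-1 <= abel_dini g h.
Proof.
move=> g01; have d0 : 0 < 1 + \sum_(0 <= i < h.+1) g i.
  by rewrite ltr_pwDl// sumr_ge0// => i _; have /andP[] := g01 i.
rewrite lef_pV2 ?posrE ?ltr0n//.
rewrite -[h.+2%:R]natr1 addrC lerD2r.
apply: (@le_trans _ _ (\sum_(0 <= i < h.+1) 1)); last by rewrite sumr_const_nat subn0.
by apply: ler_sum => i _; have /andP[] := g01 i.
Qed.

Lemma unbounded_sums_nneseries f (P : pred nat) : (forall h, P h -> 0 <= f h) ->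
  (\sum_(1 <= h <oo | P h) (f h)%:E)%E = +oo%E ->
  unbounded_sums (fun h => if (0 < h)%N && P h then f h else 0).
Proof.
move=> f0 hoo; apply: contrapT => /bounded_sums[M hM].
have : (\sum_(1 <= h <oo | P h) (f h)%:E <= M%:E)%E.
  apply: lime_le; first by apply: is_cvg_nneseries => h _ Ph; rewrite lee_fin f0.
  apply: nearW => N; rewrite sumEFin lee_fin; apply: le_trans (hM N).
  case: N => [|N]; first by rewrite !big_geq.
  rewrite [leRHS]big_ltn//= add0r big_mkcond/=.
  by apply: ler_sum_nat => h /andP[h1 _]; rewrite h1.
by rewrite hoo.
Qed.

(** This is e < 3: from expR (-1/8) >= 7/8 one gets e <= (8/7)^8 < 3. It makes ln ln S positive for
    S >= 3. *)
Lemma ln3_gt1 : 1 < ln 3 :> R.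
Proof.
rewrite -ltr_expR lnK ?posrE//.
have h : expR (8^-1) <= 8 / 7 :> R.
  have := @expR_ge1Dx R (- 8^-1); rewrite expRN => h.
  have e0 := @expR_gt0 R 8^-1.
  have := ler_wpM2r (ltW e0) h; rewrite mulVf; last by rewrite gt_eqF.
  lra.
have -> : 1 = 8%:R * 8^-1 :> R by rewrite mulfV.
rewrite expRM_natl; apply: (@le_lt_trans _ _ ((8 / 7) ^+ 8)).
  by rewrite lerXn2r ?nnegrE ?expR_ge0.
lra.
Qed.

Lemma sum_inv_sqr_le (a b : nat) : (0 < a)%N -> (a <= b)%N ->
  \sum_(a.+1 <= n < b.+1) (n%:R ^+ 2)^-1 <= a%:R^-1 - b%:R^-1 :> R.
Proof.
move=> a0; elim: b => [|b IH]; first by rewrite leqn0 => /eqP a00; rewrite a00 in a0.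
rewrite leq_eqVlt => /predU1P[->|ab]; first by rewrite big_geq// subrr.
rewrite big_nat_recr//= (le_trans (lerD (IH ab) (lexx _)))//.
have b0 : 0 < b%:R :> R by rewrite ltr0n (leq_trans a0).
rewrite -[b.+1%:R]natr1; move: (b%:R) b0 => z z0.
have -> : (z + 1)^-1 = z^-1 - (z * (z + 1))^-1 by field; rewrite !gt_eqF//; lra.
have hv : (z + 1) ^- 2 <= (z * (z + 1))^-1.
  by rewrite lef_pV2 ?posrE ?mulr_gt0 ?exprn_gt0//; nra.
lra.
Qed.

End Series.

(** * Truncated block sums and the loss in terms of the divergent series *)

Section BlockSums.
Context {R : realType}.
Variable psi : nat -> R.
Hypothesis psi_ge0 : forall n : nat, (0 < n)%N -> 0 <= psi n.
Implicit Types (h n K : nat).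

(* Dropping the values below [n^-2] costs at most 1 in each block sum and bounds the
   remaining radii from below. *)
Definition psi_trunc n : R := if (n%:R ^+ 2)^-1 <= psi n then psi n else 0.

Definition trunc_sum h : R := \sum_(n <- block h) psi_trunc n * (totient n)%:R / n%:R.

(** The number of dilations allowed: for k below it, 2^-k times the truncated sum is still at least
    1. *)
Definition log_sum h : nat := trunc_log 2 (Num.trunc (trunc_sum h)).

Lemma block_gt0 h n : n \in block h -> (0 < n)%N.
Proof. by rewrite mem_block => /andP[+ _]; exact: leq_ltn_trans. Qed.

Lemma psi_trunc_ge0 n : (0 < n)%N -> 0 <= psi_trunc n.
Proof. by move=> n0; rewrite /psi_trunc; case: ifP => // _; exact: psi_ge0. Qed.

Lemma psi_trunc_le n : (0 < n)%N -> psi_trunc n <= psi n.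
Proof. by move=> n0; rewrite /psi_trunc; case: ifP => // _; exact: psi_ge0. Qed.

Lemma totient_ratio_le1 n : (totient n)%:R / n%:R <= 1 :> R.
Proof.
have [->|n0] := posnP n; first by rewrite invr0 mulr0.
rewrite ler_pdivrMr ?ltr0n// mul1r ler_nat totient_count_coprime.
by rewrite big_mkord -[leqRHS]card_ord -sum1_card; apply: leq_sum => i _; exact: leq_b1.
Qed.

Lemma trunc_sum_le h : trunc_sum h <= block_sum psi h.
Proof.
rewrite /trunc_sum /block_sum -/(block h) big_seq [leRHS]big_seq; apply: ler_sum => n nb.
by rewrite -!mulrA ler_wpM2r ?divr_ge0// psi_trunc_le// (block_gt0 nb).
Qed.

Lemma trunc_sum_ge h : block_sum psi h - 1 <= trunc_sum h.
Proof.
rewrite lerBlDr; apply: (@le_trans _ _ (\sum_(n <- block h)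
   (psi_trunc n * (totient n)%:R / n%:R + (n%:R ^+ 2)^-1))).
  rewrite /block_sum -/(block h) big_seq [leRHS]big_seq; apply: ler_sum => n nb.
  have n0 := block_gt0 nb; have p0 := psi_ge0 n0.
  rewrite /psi_trunc; case: ifPn => [_|]; first by rewrite lerDl invr_ge0 exprn_ge0.
  rewrite -ltNge => hlt.
  rewrite !mul0r add0r -mulrA (le_trans _ (ltW hlt))// ler_piMr//.
  exact: totient_ratio_le1.
rewrite big_split/= lerD2l.
have e1 : (2 ^ 2 ^ h <= 2 ^ 2 ^ h.+1)%N by rewrite !leq_exp2l.
have e0 : (0 < 2 ^ 2 ^ h)%N by rewrite expn_gt0.
rewrite (le_trans (sum_inv_sqr_le e0 e1))// lerBlDr ler_wpDr ?invr_ge0// invf_le1 ?ltr0n//.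
by rewrite ler1n.
Qed.

Lemma log_sum_bounds h : 3 <= block_sum psi h ->
  [/\ (0 < log_sum h)%N, 2 ^+ log_sum h <= trunc_sum h,
      ln (block_sum psi h) <= 3 * (log_sum h)%:R &
      (log_sum h)%:R <= 2 * ln (block_sum psi h)].
Proof.
move=> S3; have h1 := trunc_sum_le h; have h2 := trunc_sum_ge h.
have S2 : 2 <= trunc_sum h by lra.
have S0 : 0 <= trunc_sum h by lra.
have /andP[t1 t2] := truncn_itv S0; set t := Num.trunc _ in t1 t2.
have t3 : (1 < t)%N.
  by rewrite -ltnS -(ltr_nat R) (le_lt_trans _ t2).
have t0 : (0 < t)%N by apply: ltn_trans t3.
have /andP[k1 k2] := trunc_log_bounds (isT : (1 < 2)%N) t0.
rewrite -/(log_sum h) in k1 k2; set K := log_sum h in k1 k2 *.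
have K0 : (0 < K)%N by rewrite /K /log_sum -/t trunc_log_gt0.
have K1 : 1 <= K%:R :> R by rewrite ler1n.
have l2 := @ln2_le1 R.
have l2' : 2^-1 <= ln 2 :> R.
  have := @le_ln1Dx R (2^-1 - 1); rewrite (_ : 1 + (2^-1 - 1) = 2^-1); last by ring.
  by rewrite lnV ?posrE// => /(_ ltac:(lra)); lra.
have KS : 2 ^+ K <= trunc_sum h by rewrite (le_trans _ t1)// -natrX ler_nat.
split => //.
  apply: (@le_trans _ _ (ln (2 ^+ K.+2))).
    rewrite ler_ln ?posrE ?exprn_gt0//; last lra.
    have : trunc_sum h <= 2 ^+ K.+1 by rewrite (le_trans (ltW t2))// -natrX ler_nat.
    have : 2 <= 2 ^+ K.+1 :> R by rewrite exprS ler_peMr// exprn_ege1// ler1n.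
    rewrite [2 ^+ K.+2]exprS; lra.
  rewrite lnXn// -[leLHS]mulr_natl -addn2 natrD; nra.
have : K%:R * ln 2 <= ln (block_sum psi h).
  rewrite mulr_natl -lnXn// ler_ln ?posrE ?exprn_gt0//; lra.
nra.
Qed.

Definition gain h : R := ln (block_sum psi h) / (h%:R * ln (ln (block_sum psi h))).

Lemma lnln_gt0 (S : R) : 3 <= S -> 0 < ln (ln S).
Proof.
move=> S3; rewrite ln_gt0// (lt_le_trans (@ln3_gt1 R))// ler_ln ?posrE//; lra.
Qed.

Lemma gain_ge0 h : 3 <= block_sum psi h -> 0 <= gain h.
Proof.
move=> S3; rewrite divr_ge0 ?mulr_ge0// ?ltW ?lnln_gt0//.
rewrite ln_gt0//; lra.
Qed.

Lemma loss_le : exists2 C : R, 0 < C & forall h, (0 < h)%N -> 3 <= block_sum psi h ->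
  loss (2 ^ h.+2) (log_sum h) <= 1 + C / gain h.
Proof.
have l3 := @lnln_gt0 3 (lexx _).
(* 18 = 2 * 3 * 3, from the factor 2 in [loss], ln T <= 3 h and 1/K <= 3 / ln S. Since 1 + ln K <= 2
   + ln ln S and ln ln S >= ln (ln 3), the constant 2 is absorbed by 2 / ln (ln 3). *)
exists (18 * (1 + 2 / ln (ln 3))); first by rewrite mulr_gt0// ltr_pwDl// divr_ge0// ltW.
move=> h h0 S3; have [K0 _ LK KL] := log_sum_bounds S3.
rewrite /loss lerD2l /gain; set S := block_sum psi h in S3 LK KL *.
set K := log_sum h in K0 LK KL *.
have LL0 := lnln_gt0 S3; set LL := ln (ln S) in LL0 *.
have L0 : 0 < ln S by rewrite ln_gt0//; lra.
have hR : 1 <= h%:R :> R by rewrite ler1n.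
have K1 : 1 <= K%:R :> R by rewrite ler1n.
have LL3 : ln (ln 3) <= LL.
  have : ln 3 <= ln S by rewrite ler_ln ?posrE//; lra.
  have := @ln3_gt1 R => h3 h4; rewrite /LL ler_ln ?posrE//; lra.
have hT : ln (2 ^ h.+2)%:R <= 3 * h%:R :> R.
  rewrite ln_natX2 -[leLHS]mulr_natl -addn2 natrD.
  have := @ln2_le1 R; have := @ln2_gt0 R; nra.
have hT0 : 0 <= ln (2 ^ h.+2)%:R :> R by exact: ln_nat_ge0.
have hK : 1 + ln K%:R <= (1 + 2 / ln (ln 3)) * LL.
  have : ln K%:R <= ln 2 + LL.
    rewrite /LL -lnM ?posrE// ler_ln ?posrE ?mulr_gt0//; lra.
  have := @ln2_le1 R.
  have : 2 <= 2 / ln (ln 3) * LL by rewrite mulrAC ler_pdivlMr// ler_pM2l.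
  lra.
have hK0 : 0 <= 1 + ln K%:R :> R by rewrite addr_ge0// ln_nat_ge0.
have hKi : K%:R^-1 <= 3 / ln S.
  by rewrite -[leLHS]mul1r ler_pdivrMr ?ltr0n// mulrAC ler_pdivlMr// mul1r.
have -> : 18 * (1 + 2 / ln (ln 3)) / (ln S / (h%:R * LL)) =
    2 * (3 * h%:R) * ((1 + 2 / ln (ln 3)) * LL) * (3 / ln S).
  by field; rewrite !gt_eqF//; lra.
apply: ler_pM.
- by rewrite !mulr_ge0.
- by rewrite invr_ge0.
- by apply: ler_pM => //; [rewrite mulr_ge0|rewrite ler_pM2l].
- exact: hKi.
Qed.

Lemma loss_ge1 T K : 1 <= loss T K :> R.
Proof.
rewrite /loss lerDl divr_ge0// mulr_ge0 ?mulr_ge0 ?ln_nat_ge0//.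
by rewrite addr_ge0// ln_nat_ge0.
Qed.

End BlockSums.

(** * Lifting to the line, and overlaps of distant blocks *)

Section Circle.
Context {R : realType}.
Variable psi : nat -> R.
Local Notation mu := (@lebesgue_measure R).
Local Notation meas A := (measurable (A : set (measurableTypeR R))).
Implicit Types (x y : R) (n M : nat).

Definition limsup_lift : set R :=
  [set x | forall M, exists2 n, (M <= n)%N & (0 < n)%N /\ approx n (psi n / n%:R) x].

Lemma proj_circle_eq x y : proj_circle x = proj_circle y <-> x - y \is a Num.int.
Proof.
split; first by move/eqquotP.
by move=> h; apply/eqquotP.
Qed.

Lemma limsup_lift_iff x : limsup_lift x <-> limsup_approx psi (proj_circle x).
Proof.
split=> [hx m m1|hx M].
  have [n mn [n0 [a an h]]] := hx m; exists n => //.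
  have nz : (n : int) != 0 by rewrite eqz_nat -lt0n.
  (* Reducing a - 1 instead of a yields a representative r + 1 in the range 1..n required by
     [approx_set]. *)
  have r0 := modz_ge0 (a - 1) nz; have r1 := ltz_mod (a - 1) nz.
  have e := divz_eq (a - 1) n.
  set r := ((a - 1) %% n)%Z in r0 r1 e; set k := ((a - 1) %/ n)%Z in e.
  have aE : a = k * n + `|r|.+1%N by rewrite -addn1 PoszD (gez0_abs r0); lia.
  exists `|r|.+1.
    split; first by rewrite /=; lia.
    by move: an; rewrite aE coprimez_sym /coprimez gcdzMDl -/(coprimez _ _) coprimez_sym coprimezE.
  have n0' : 0 < n%:R :> R by rewrite ltr0n.
  exists (x - k%:~R); last first.
    by apply/proj_circle_eq; rewrite addrAC subrr add0r rpredN intr_int.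
  rewrite /= in_itv/= ltr_pdivrMr// ltr_pdivlMr//.
  move: h; rewrite ltr_norml aE => /andP[].
  have -> : (k * n + `|r|.+1)%:~R / n%:R = k%:~R + `|r|.+1%:R / n%:R :> R.
    by rewrite intrD intrM -!pmulrn mulrDl mulfK// gt_eqF.
  move=> h1 h2; have {}h1 : - psi n < (x - k%:~R) * n%:R - `|r|.+1%:R.
    move: h1; rewrite -(ltr_pM2r n0') mulNr divfK ?gt_eqF// mulrBl mulrDl.
    rewrite divfK ?gt_eqF// mulrBl; lra.
  have {}h2 : (x - k%:~R) * n%:R - `|r|.+1%:R < psi n.
    move: h2; rewrite -(ltr_pM2r n0') divfK ?gt_eqF// mulrBl mulrDl.
    rewrite divfK ?gt_eqF// mulrBl; lra.
  by apply/andP; split; lra.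
(* [M.+1] meets the condition that the index be positive, and it forces n > 0. *)
have [|n Mn [m [/andP[m1 mn] cmn] [y yI yx]]] := hx M.+1; first by [].
exists n; first exact: ltnW.
have n0 : (0 < n)%N by apply: leq_trans Mn.
have n0' : 0 < n%:R :> R by rewrite ltr0n.
split=> //; have /proj_circle_eq/intrP[k kE] := yx.
exists (m%:Z - k * n).
  rewrite coprimez_sym /coprimez addrC -mulNr gcdzMDl -/(coprimez _ _) coprimez_sym.
  by rewrite coprimezE.
have -> : x = y - k%:~R by rewrite -kE; ring.
rewrite intrB intrM -!pmulrn mulrBl mulfK ?gt_eqF//.
have -> : y - k%:~R - (m%:R / n%:R - k%:~R) = y - m%:R / n%:R by ring.
by move: yI; rewrite /= in_itv/= ltr_norml mulrBl mulrDl; lra.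
Qed.

Lemma measurable_limsup_lift : meas limsup_lift.
Proof.
have -> : limsup_lift = \bigcap_M \bigcup_(n in [set n | (M <= n)%N /\ (0 < n)%N])
    approx n (psi n / n%:R).
  apply/seteqP; split => x.
    by move=> hx M _; have [n Mn [n0 ax]] := hx M; exists n.
  by move=> hx M; have [n [Mn n0] ax] := hx M I; exists n.
apply: bigcap_measurable; first by exists 0%N.
by move=> M _; apply: bigcup_measurable => n _; exact: measurable_approx.
Qed.

Lemma circle_measure_limsup : mu (~` limsup_lift) = 0%E ->
  circle_measure (limsup_approx psi) = 1%E.
Proof.
move=> h0; rewrite /circle_measure.
have -> : @proj_circle R @^-1` (limsup_approx psi) = limsup_lift.
  by apply/seteqP; split => x /= /limsup_lift_iff.
have mW := measurable_limsup_lift.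
pose I01 : set R := `[0, 1[%classic.
have mI : meas I01 by exact: measurable_itv.
have DI := measureDI mu mI mW.
have h1 : (mu (I01 `\` limsup_lift) = 0)%E.
  apply/eqP; rewrite eq_le measure_ge0 andbT -h0.
  by apply: le_mu; [exact: measurableD|exact: measurableC|move=> x []].
have h2 : (mu I01 = 1)%E.
  by rewrite /I01 lebesgue_measure_itv/= lte_fin ltr01 oppr0 adde0.
have DI' : (mu I01 = mu (I01 `\` limsup_lift) + mu (I01 `&` limsup_lift))%E by exact: DI.
by move: DI'; rewrite h1 add0e h2 => <-.
Qed.

(** The numerator floor(x) n + 1 is coprime to n, and for n >= 2 its fraction is at distance less
    than 1 from x, while the radius is at least 1. *)
Lemma limsup_lift_full : (forall H, exists2 n, (H <= n)%N & n%:R <= psi n) ->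
  mu (~` limsup_lift) = 0%E.
Proof.
move=> hH; suff -> : limsup_lift = setT by rewrite setCT measure0.
apply/seteqP; split => // x _ M; have [n Mn pn] := hH M.+2.
exists n; first by rewrite 2?ltnW.
have n0 : (0 < n)%N by apply: leq_trans Mn.
have n0' : 0 < n%:R :> R by rewrite ltr0n.
split=> //; exists (Num.floor x * n + 1).
  by rewrite coprimez_sym /coprimez gcdzMDl -/(coprimez _ _) coprimezE coprimen1.
have /andP[f1 f2] := floor_itv x.
have i0 : 0 < n%:R^-1 :> R by rewrite invr_gt0.
have i1 : n%:R^-1 <= 2^-1 :> R by rewrite lef_pV2 ?posrE// ler_nat (leq_trans _ Mn).
have p1 : 1 <= psi n / n%:R by rewrite ler_pdivlMr// mul1r.
apply: lt_le_trans p1.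
rewrite intrD intrM mulrDl -pmulrn mulfK ?gt_eqF// mul1r.
by move: f2; rewrite intrD ltr_norml; lra.
Qed.

End Circle.

(** * Overlaps between distant blocks *)

Section CrossBlock.
Context {R : realType}.
Implicit Types (h m n T : nat).

Lemma overlap_countC m n (D : R) : overlap_count m n D = overlap_count n m D.
Proof.
rewrite /overlap_count exchange_big_nat/=; apply: eq_bigr => b _.
by apply: eq_bigr => a _; rewrite distrC.
Qed.

Lemma overlapC m n (r s : R) : overlap m n r s = overlap n m s r.
Proof. by rewrite /overlap minC overlap_countC addrC. Qed.

Lemma kappa_le T (E : nat) (Y : R) : 1 <= Y -> 2 ^+ E <= Y -> ln T%:R <= 4 * E%:R * ln 2 :> R ->
  kappa T Y <= 5.
Proof.
move=> Y1 EY TE; rewrite /kappa Y1.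
have : E%:R * ln 2 <= ln Y.
  by rewrite mulr_natl -lnXn// ler_ln ?posrE ?exprn_gt0//; apply: lt_le_trans EY; rewrite exprn_gt0.
have l0 : 0 <= E%:R * ln 2 :> R by rewrite mulr_ge0// ltW// ln2_gt0.
move=> h; suff : ln T%:R / (1 + ln Y) <= 4 by lra.
rewrite ler_pdivrMr; lra.
Qed.

(* The lower bound on [x] and [2 ^ 2 ^ h' < n] make the argument of [kappa] at least
   [2 ^ 2 ^ (h' - 2)], whose logarithm is comparable to [ln (2 ^ h'.+2)] or larger. *)
Lemma cross_kappa h h' m n (x y : R) : (h + 4 <= h')%N ->
  m \in block h -> n \in block h' -> 0 <= y ->
  ((h.+2)%:R * (2 ^ 2 ^ h.+1)%:R ^+ 2 * m%:R ^+ 3)^-1 <= x ->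
  kappa (2 ^ h'.+2) (2 * Num.max x y * m%:R * n%:R / (gcdn m n)%:R) <= 5.
Proof.
move=> hh mb nb y0 hx.
have m0 := block_gt0 mb; have n0 := block_gt0 nb.
move: mb nb; rewrite !mem_block => /andP[_ mN] /andP[nN _].
set N := (2 ^ 2 ^ h.+1)%N in hx mN *.
have Npos : (0 < N)%N by rewrite expn_gt0.
have N0 : 0 < N%:R :> R by rewrite ltr0n.
have m0' : 0 < m%:R :> R by rewrite ltr0n.
have n0' : 0 < n%:R :> R by rewrite ltr0n.
have hN : (h.+2 <= N)%N.
  rewrite /N; apply: (@leq_trans (2 ^ h.+1)); first by rewrite ltn_expl.
  by rewrite ltnW// ltn_expl.
set E := (2 ^ (h' - 2))%N.
have h4 : (4 <= h')%N by apply: leq_trans hh; rewrite leq_addl.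
(* This fixes the gap of four: 2^h' = 4 E, and 12 * 2^h <= 3 E amounts to h + 2 <= h' - 2. It yields
   n >= 2^E N^6, where N^6 compensates the lower bound N^-6 for x, obtained from h + 2 <= N and m <=
   N. *)
have EE : (E + 12 * 2 ^ h <= 2 ^ h')%N.
  have -> : (2 ^ h' = 4 * E)%N by rewrite /E -(@expnD 2 2) subnKC// (leq_trans _ h4).
  have : (2 ^ h * 4 <= E)%N by rewrite /E -(@expnD 2 h 2) leq_exp2l//; lia.
  lia.
have nE : 2 ^+ E * N%:R ^+ 6 <= n%:R :> R.
  rewrite -!natrX -natrM ler_nat (leq_trans _ (ltnW nN))//.
  rewrite /N -expnM -expnD leq_exp2l// (leq_trans _ EE)// leq_add2l expnS.
  by rewrite mulnC mulnA.
have g0 : 0 < (gcdn m n)%:R :> R by rewrite ltr0n gcdn_gt0 m0.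
have gm : (gcdn m n)%:R <= m%:R :> R by rewrite ler_nat dvdn_leq// dvdn_gcdl.
have x0 : 0 <= x by apply: le_trans hx; rewrite invr_ge0 !mulr_ge0 ?exprn_ge0.
have hx2 : (N%:R ^+ 6)^-1 <= x.
  apply: le_trans hx; rewrite lef_pV2 ?posrE ?mulr_gt0 ?exprn_gt0 ?ltr0n//.
  have -> : N%:R ^+ 6 = N%:R * N%:R ^+ 2 * N%:R ^+ 3 :> R by ring.
  apply: ler_pM; rewrite ?mulr_ge0 ?exprn_ge0//.
    by rewrite ler_wpM2r ?exprn_ge0// ler_nat.
  by rewrite lerXn2r ?nnegrE// ler_nat.
have hY : 2 ^+ E <= 2 * Num.max x y * m%:R * n%:R / (gcdn m n)%:R.
  rewrite ler_pdivlMr//.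
  apply: (@le_trans _ _ (2 ^+ E * m%:R)); first by rewrite ler_wpM2l ?exprn_ge0.
  have -> : 2 * Num.max x y * m%:R * n%:R = (2 * Num.max x y * n%:R) * m%:R by ring.
  rewrite ler_pM2r//.
  apply: (@le_trans _ _ ((N%:R ^+ 6)^-1 * n%:R)).
    by rewrite mulrC ler_pdivlMr ?exprn_gt0.
  rewrite ler_pM2r// (le_trans hx2)// (@le_trans _ _ (Num.max x y)) ?le_max ?lexx//.
  by rewrite ler_peMl ?ler1n// le_max x0.
apply: (kappa_le (E := E)) => //.
  by rewrite (le_trans _ hY)// exprn_ege1// ler1n.
rewrite ln_natX2 -[leLHS]mulr_natl ler_wpM2r ?(ltW (ln2_gt0))//.
rewrite -natrM ler_nat /E -(@expnD 2 2) subnKC ?(leq_trans _ h4)//.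
clear -h4; case: h' h4 => [|[|[|h]]]// _; elim: h => // h IH.
by rewrite expnS mul2n -addnn (leq_trans _ (leq_add IH IH))//; lia.
Qed.

End CrossBlock.

(** * The limsup set has full measure *)

Section Main.
Context {R : realType}.
Variable psi : nat -> R.
Hypothesis psi_ge0 : forall n : nat, (0 < n)%N -> 0 <= psi n.
Local Notation mu := (@lebesgue_measure R).
Local Notation meas A := (measurable (A : set (measurableTypeR R))).
Implicit Types (h n m N H : nat).

(** Since 2^k is at most the truncated sum, this bounds the chosen dilation 2^-k from below by
    N^-2. *)
Lemma trunc_sum_le_sqr h : (forall n, n \in block h -> psi n <= n%:R) ->
  trunc_sum psi h <= (2 ^ 2 ^ h.+1)%:R ^+ 2.
Proof.
move=> hpsi; set N := (2 ^ 2 ^ h.+1)%N.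
apply: (@le_trans _ _ (\sum_(n <- block h) N%:R)).
  rewrite /trunc_sum big_seq [leRHS]big_seq; apply: ler_sum => n nb.
  have n0 := block_gt0 nb.
  rewrite -mulrA (@le_trans _ _ (psi_trunc psi n))//.
    by rewrite ler_piMr ?psi_trunc_ge0// totient_ratio_le1.
  rewrite (le_trans (psi_trunc_le psi_ge0 n0))// (le_trans (hpsi n nb))// ler_nat.
  by move: nb; rewrite mem_block => /andP[].
rewrite sumr_const_nat -[leLHS]mulr_natl expr2 ler_wpM2r// ler_nat.
by rewrite subSS leq_subr.
Qed.

Lemma gain_gt0 h : (0 < h)%N -> 3 <= block_sum psi h -> 0 < gain psi h.
Proof.
move=> h0 S3; rewrite divr_gt0 ?mulr_gt0 ?ltr0n ?lnln_gt0// ln_gt0//; lra.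
Qed.

(** The second moment runs over single balls, indexed by (h, (n, a)), and not over unions for each
    n: first moments are then exact without disjointness, and [lebesgue_ballI] bounds each
    intersection. The resulting bound does not depend on [M]. *)
Lemma second_moment_set (U : set R) (hs : seq nat) (w : nat -> R) (d : nat -> nat -> R)
    (s : nat -> R) (C3 M : R) :
  (forall h, 0 <= w h) -> (forall h n, 0 <= d h n) ->
  (forall h, s h = \sum_(n <- block h) d h n * (totient n)%:R) ->
  0 < C3 -> 0 < M -> \sum_(h <- hs) w h * s h = M ->
  \sum_(h <- hs) \sum_(h' <- hs) w h * w h' *
    (\sum_(m <- block h) \sum_(n <- block h') overlap m n (d h m) (d h' n)) <= C3 * M ^+ 2 ->
  meas U ->
  (forall h n a, h \in hs -> n \in block h -> (1 <= a < n.+1)%N -> coprime a n ->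
     ball (a%:R / n%:R : R) (d h n) `<=` U) ->
  ((4 / C3)%:E <= mu U)%E.
Proof.
move=> w0 d0 sE C30 M0 hM hQ mU hU.
pose cop n := [seq a <- index_iota 1 n.+1 | coprime a n].
pose ix : seq (nat * (nat * nat)) :=
  [seq (h, p) | h <- hs, p <- [seq (n, a) | n <- block h, a <- cop n]].
pose A (i : nat * (nat * nat)) : set R := ball (i.2.2%:R / i.2.1%:R : R) (d i.1 i.2.1).
pose W (i : nat * (nat * nat)) := w i.1.
pose r (i : nat * (nat * nat)) := 2 * d i.1 i.2.1.
pose q (i j : nat * (nat * nat)) := 2 * Num.min (d i.1 i.2.1) (d j.1 j.2.1) *
  (`|i.2.2%:R / i.2.1%:R - j.2.2%:R / j.2.1%:R| < d i.1 i.2.1 + d j.1 j.2.1)%R%:R.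
have sumix (F : nat * (nat * nat) -> R) : \sum_(i <- ix) F i =
    \sum_(h <- hs) \sum_(n <- block h) \sum_(1 <= a < n.+1 | coprime a n) F (h, (n, a)).
  rewrite /ix big_allpairs_dep; apply: eq_bigr => h _.
  rewrite big_allpairs_dep; apply: eq_bigr => n _.
  by rewrite /cop big_filter.
have first : \sum_(i <- ix) W i * r i = 2 * M.
  rewrite sumix -hM mulr_sumr; apply: eq_bigr => h _.
  rewrite sE !mulr_sumr; apply: eq_bigr => n _.
  rewrite /W /r /= -(@sum_coprime R n) !mulr_sumr; apply: eq_bigr => a _; ring.
have second : \sum_(i <- ix) \sum_(j <- ix) W i * W j * q i j <= C3 * M ^+ 2.
  apply: le_trans hQ; rewrite le_eqVlt; apply/orP; left; apply/eqP.
  rewrite sumix; apply: eq_bigr => h _.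
  under eq_bigr => m _ do under eq_bigr => a _ do rewrite sumix.
  under eq_bigr => m _ do rewrite exchange_big/=.
  rewrite exchange_big/=; apply: eq_bigr => h' _.
  rewrite mulr_sumr; apply: eq_bigr => m _.
  rewrite exchange_big/= mulr_sumr; apply: eq_bigr => n _.
  rewrite /overlap /overlap_count !mulr_sumr; apply: eq_bigr => a _.
  rewrite !mulr_sumr; apply: eq_bigr => b _.
  by rewrite /W /q /= !mulrA.
(* The optimal parameter: it gives 4 M <= 2 M + (C3 M / 2) mu U. *)
pose t := 2 / (C3 * M).
have t0 : 0 < t by rewrite divr_gt0 ?mulr_gt0.
have h1 : ((2 * \sum_(i <- ix) W i * r i)%:E <=
    (t * \sum_(i <- ix) \sum_(j <- ix) W i * W j * q i j)%:E + (t^-1)%:E * mu U)%E.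
  apply: (@second_moment R _ ix A) => //.
  - by move=> i; exact: w0.
  - by move=> i; exact: measurable_ball.
  - move=> i; rewrite /ix => /allpairsPdep[h [p [hh hp ->]]].
    move: hp => /allpairsPdep[n [a [nb]]]; rewrite mem_filter mem_index_iota => /andP[ca ha] ->.
    exact: hU.
  - move=> i; rewrite /A lebesgue_measure_ball// /r; congr (_%:E).
    by rewrite mulr_natl.
  - by move=> i j; apply: lebesgue_ballI.
rewrite first in h1.
have h2 : ((2 * (2 * M))%:E <= (2 * M)%:E + (t^-1)%:E * mu U)%E.
  apply: (le_trans h1); apply: leeD => //; rewrite lee_fin.
  apply: (@le_trans _ _ (t * (C3 * M ^+ 2))); first by rewrite ler_pM2l.
  by rewrite /t le_eqVlt; apply/orP; left; apply/eqP; field; rewrite !gt_eqF.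
have ti : t^-1 = C3 * M / 2 by rewrite /t invf_div.
have m0 : (0%:E <= mu U)%E by exact: measure_ge0.
move: h2 m0; rewrite ti; case: (mu U) => [u||] h2; rewrite ?leey// => _.
move: h2; rewrite -EFinM -EFinD !lee_fin => h2.
rewrite ler_pdivrMr//; rewrite -(ler_pM2r M0); lra.
Qed.

Lemma limsup_conull (h0 : nat) : (forall n, (h0 <= n)%N -> psi n < n%:R) ->
  unbounded_sums (fun h => if (0 < h)%N && (3 <= block_sum psi h) then gain psi h else 0) ->
  mu (~` limsup_lift psi) = 0%E.
Proof.
move=> hpsi unb.
have f0 h : 0 <= (if (0 < h)%N && (3 <= block_sum psi h) then gain psi h else 0).
  by case: ifP => // /andP[_]; exact: gain_ge0.
have [c unbc] := unbounded_sums_class f0 unb.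
have fc0 h : 0 <= (if (h %% 4 == c)%N then
    (if (0 < h)%N && (3 <= block_sum psi h) then gain psi h else 0) else 0).
  by case: ifP.
have unb0 := unbounded_sums_tail h0 fc0 unbc.
pose act h := [&& (h0 <= h)%N, (h %% 4 == c)%N, (0 < h)%N & 3 <= block_sum psi h].
pose f h := if act h then gain psi h else 0.
have fE h : (if (h0 <= h)%N then (if (h %% 4 == c)%N then
    (if (0 < h)%N && (3 <= block_sum psi h) then gain psi h else 0) else 0) else 0) = f h.
  by rewrite /f /act; do 2!case: ifP => //=.
have unbf : unbounded_sums f.
  by move=> M; have [N hN] := unb0 M; exists N; rewrite -(eq_bigr _ (fun h _ => fE h)).
have ff0 h : 0 <= f h by rewrite -fE; case: ifP.
have [C C0 hC] := loss_le psi_ge0.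
(* The weight is the inverse of the actual loss; [loss_le] bounds it below by gain / (gain + C), so
   that its sums diverge by [unbounded_sums_ratio]. *)
pose g h := if act h then (loss (2 ^ h.+2) (log_sum psi h))^-1 else 0 : R.
have g01 h : 0 <= g h <= 1.
  rewrite /g; case: ifP => _; last by rewrite lexx ler01.
  have l1 := @loss_ge1 R (2 ^ h.+2) (log_sum psi h).
  by rewrite invr_ge0 (le_trans ler01 l1)/= invf_le1// (lt_le_trans ltr01 l1).
have g0 h : 0 <= g h by have /andP[] := g01 h.
have unbg : unbounded_sums g.
  move=> M; have [N hN] := unbounded_sums_ratio C0 ff0 unbf M; exists N.
  apply: (lt_le_trans hN); apply: ler_sum => h _; rewrite /f /g.
  case: ifP => [/and4P[_ _ hh S3]|_]; last by rewrite mul0r.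
  have gp := gain_gt0 hh S3; have := hC h hh S3.
  have l1 := @loss_ge1 R (2 ^ h.+2) (log_sum psi h).
  have -> : 1 + C / gain psi h = (gain psi h / (gain psi h + C))^-1.
    by move: (gain psi h) gp => G gp; rewrite invf_div mulrDl mulfV ?gt_eqF.
  have lp := lt_le_trans ltr01 l1.
  have qp : 0 < (gain psi h / (gain psi h + C))^-1.
    by rewrite invr_gt0 divr_gt0// addr_gt0.
  by move=> hl; rewrite -[leLHS]invrK lef_pV2 ?posrE.
pose e h := abel_dini g h.
have e0 h : 0 < e h by exact: abel_dini_gt0.
have e1 h : e h <= 1 by exact: abel_dini_le1.
pose r h n := e h * psi_trunc psi n / n%:R.
have r0 h n : 0 <= r h n.
  have [->|n0] := posnP n; first by rewrite /r invr0 mulr0.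
  by rewrite /r divr_ge0 ?mulr_ge0 ?psi_trunc_ge0// ltW.
have [C1 C10 hC1] := @block_choice R.
have /choice[k hk] : forall h, exists k, act h -> (k < log_sum psi h)%N /\
    \sum_(m <- block h) \sum_(n <- block h) overlap m n (2 ^- k * r h m) (2 ^- k * r h n) <=
  2 * (\sum_(n <- block h) 2 ^- k * r h n * (totient n)%:R) +
  C1 * (\sum_(n <- block h) 2 ^- k * r h n * (totient n)%:R) ^+ 2 *
    loss (2 ^ h.+2) (log_sum psi h).
  move=> h; case ah: (act h); last by exists 0%N.
  have /and4P[_ _ hh S3] := ah; have [K0 _ _ _] := log_sum_bounds psi_ge0 S3.
  by have [k k1 k2] := hC1 h _ (r h) K0 (r0 h); exists k.
pose d h n := 2 ^- k h * r h n.
have p0 (j : nat) : 0 < 2 ^- j :> R by rewrite invr_gt0 exprn_gt0.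
have d0 h n : 0 <= d h n by rewrite mulr_ge0// ltW.
pose s h := \sum_(n <- block h) d h n * (totient n)%:R.
have sE h : s h = 2 ^- k h * e h * trunc_sum psi h.
  rewrite /s /trunc_sum mulr_sumr; apply: eq_bigr => n _.
  by rewrite /d /r; ring.
have s_ge h : act h -> e h <= s h.
  move=> ah; have /and4P[_ _ hh S3] := ah; have [_ KS _ _] := log_sum_bounds psi_ge0 S3.
  have [kK _] := hk h ah; rewrite sE mulrAC ler_peMl// ?(ltW (e0 h))//.
  rewrite mulrC ler_pdivlMr ?exprn_gt0// mul1r (le_trans _ KS)//.
  by rewrite ler_eXn2l ?ltr1n// ltnW.
have s_gt0 h : act h -> 0 < s h by move=> ah; apply: lt_le_trans (s_ge h ah).
(* Normalised so that the weighted mass [w h * s h] is [e h * g h], whichever dilation was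
   chosen. *)
pose w h := if act h then e h * g h / s h else 0.
have w0 h : 0 <= w h.
  by rewrite /w; case: ifP => // ah; rewrite divr_ge0 ?mulr_ge0// ltW// s_gt0.
have ws h : act h -> w h * s h = e h * g h.
  by move=> ah; rewrite /w ah divfK// gt_eqF// s_gt0.
have d_le h n : act h -> n \in block h -> d h n <= e h * (psi n / n%:R).
  move=> ah nb; have n0 := block_gt0 nb.
  apply: (@le_trans _ _ (r h n)).
    by rewrite /d ler_piMl// invf_le1 ?exprn_gt0// exprn_ege1// ler1n.
  by rewrite /r -mulrA ler_pM2l// ler_wpM2r// psi_trunc_le.
have block_ge h n : n \in block h -> (h <= n)%N.
  rewrite mem_block => /andP[h1 _]; apply: leq_trans (ltnW h1).
  by apply: (@leq_trans (2 ^ h)); apply: ltnW; exact: ltn_expl.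
have psi_lt h n : act h -> n \in block h -> psi n < n%:R.
  by move=> /and4P[h0h _ _ _] nb; apply: hpsi; apply: leq_trans h0h (block_ge _ _ nb).
have [C2 C20 hC2] := @overlap_bound R.
have cross h h' m n : act h -> act h' -> (h < h')%N -> m \in block h -> n \in block h' ->
    overlap m n (d h m) (d h' n) <=
    5 * C2 * ((d h m * (totient m)%:R) * (d h' n * (totient n)%:R)).
  move=> ah ah' hh mb nb.
  have m0 := block_gt0 mb; have n0 := block_gt0 nb.
  have h4 : (h + 4 <= h')%N.
    by have /and4P[_ /eqP hc _ _] := ah; have /and4P[_ /eqP hc' _ _] := ah'; lia.
  have [pm|pm] := boolP ((m%:R ^+ 2)^-1 <= psi m); last first.
    have -> : d h m = 0 by rewrite /d /r /psi_trunc (negbTE pm) mulr0 mul0r mulr0.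
    rewrite /overlap (min_idPl _)// !mulr0 !mul0r !mulr0 //.
  (* The three factors come from e h >= 1 / (h + 2), from 2^-k >= N^-2, and from psi m / m >= m^-3
     after truncation. *)
  have hx : ((h.+2)%:R * (2 ^ 2 ^ h.+1)%:R ^+ 2 * m%:R ^+ 3)^-1 <= d h m.
    have /and4P[_ _ hh0 S3] := ah; have [_ KS _ _] := log_sum_bounds psi_ge0 S3.
    have [kK _] := hk h ah.
    have TN := trunc_sum_le_sqr (fun n nb => ltW (psi_lt h n ah nb)).
    have k1 : ((2 ^ 2 ^ h.+1)%:R ^+ 2)^-1 <= 2 ^- k h :> R.
      rewrite lef_pV2 ?posrE ?exprn_gt0// ?ltr0n ?expn_gt0//.
      apply: le_trans TN; apply: le_trans KS.
      by rewrite ler_eXn2l ?ltr1n// ltnW.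
    have k2 : (h.+2%:R)^-1 <= e h by exact: abel_dini_ge.
    rewrite /d /r /psi_trunc pm.
    have m0' : 0 < m%:R :> R by rewrite ltr0n.
    have invE (x y z : R) : 0 < x -> 0 < y -> 0 < z ->
        (x * y ^+ 2 * z ^+ 3)^-1 = y ^- 2 * (x^-1 * z ^- 2 / z).
      by move=> x0 y0 z0; field; rewrite !gt_eqF.
    rewrite invE// ?ltr0n ?expn_gt0//.
    apply: ler_pM; [by rewrite invr_ge0 exprn_ge0| |exact: k1|].
      by rewrite !mulr_ge0 ?invr_ge0 ?exprn_ge0.
    rewrite ler_pM2r ?invr_gt0//; apply: ler_pM; [|  |exact: k2|exact: pm].
      by rewrite invr_ge0.
    by rewrite invr_ge0 exprn_ge0.
  have T1 : (1 < 2 ^ h'.+2)%N by rewrite -[X in (X < _)%N](expn0 2) ltn_exp2l.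
  have hb : (2 ^ 2 ^ h.+1 <= 2 ^ 2 ^ h')%N by rewrite !leq_exp2l.
  move: (mb) (nb); rewrite !mem_block => /andP[_ mN] /andP[nN nN'].
  have mn : (m < n)%N by rewrite (leq_ltn_trans mN)// (leq_ltn_trans hb).
  have mnT : (m * n <= 2 ^ 2 ^ h'.+2)%N.
    rewrite [X in (_ <= 2 ^ X)%N]expnS mul2n -addnn expnD leq_mul//.
    by rewrite (leq_trans (ltnW mn)).
  have := hC2 _ m n (d h m) (d h' n) m0 n0 mnT T1 (d0 h m) (d0 h' n).
  rewrite (ltn_eqF mn) mul0r add0r -/(overlap _ _ _ _) => /le_trans; apply.
  have -> : 5 * C2 * (d h m * (totient m)%:R * (d h' n * (totient n)%:R)) =
    C2 * (d h m * (totient m)%:R) * (d h' n * (totient n)%:R) * 5 by ring.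
  apply: ler_wpM2l; last exact: cross_kappa h4 mb nb (d0 _ _) hx.
  apply: mulr_ge0; last by apply: mulr_ge0 => //; exact: d0.
  apply: mulr_ge0; first exact: ltW.
  by apply: mulr_ge0 => //; exact: d0.
pose O h h' := \sum_(m <- block h) \sum_(n <- block h') overlap m n (d h m) (d h' n).
have crossO h h' : act h -> act h' -> (h < h')%N -> O h h' <= 5 * C2 * (s h * s h').
  move=> ah ah' hh; rewrite /O /s mulr_suml mulr_sumr big_seq [leRHS]big_seq.
  apply: ler_sum => m mb; rewrite !mulr_sumr big_seq [leRHS]big_seq.
  by apply: ler_sum => n nb; exact: cross.
have OC h h' : O h h' = O h' h.
  rewrite /O exchange_big/=; apply: eq_bigr => m _; apply: eq_bigr => n _.
  exact: overlapC.
pose v h := e h * g h.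
have v0 h : 0 <= v h by rewrite mulr_ge0// ltW.
(* On the diagonal the linear term is 2 v (v / s) <= 2 v, since v <= e <= s. In the quadratic term
   the weight g cancels the loss: C1 v^2 / g = C1 v e <= C1 v. *)
have wO h h' : act h -> act h' ->
    w h * w h' * O h h' <= (h' == h)%:R * ((2 + C1) * v h) + 5 * C2 * (v h * v h').
  move=> ah ah'; have [hh|hh|->] := ltngtP h h'; last first.
  - rewrite mul1r -[leLHS]addr0 lerD//; last by rewrite !mulr_ge0// ltW.
    have [_ hO] := hk h' ah'.
    apply: (@le_trans _ _ (w h' * w h' * (2 * s h' + C1 * s h' ^+ 2 * (g h')^-1))).
      by rewrite ler_wpM2l ?mulr_ge0// /g ah' invrK.
    have sp := s_gt0 h' ah'.
    have gp : 0 < g h'.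
      by rewrite /g ah' invr_gt0 (lt_le_trans ltr01)// loss_ge1.
    have -> : w h' * w h' * (2 * s h' + C1 * s h' ^+ 2 / g h') =
        2 * (w h' * s h') * (w h' * s h' / s h') + C1 * ((w h' * s h') * (w h' * s h') / g h').
      by field; rewrite !gt_eqF.
    rewrite ws// -/(v h') [leRHS]mulrDl lerD//.
      apply: ler_piMr; first by apply: mulr_ge0.
      rewrite ler_pdivrMr// mul1r (le_trans _ (s_ge h' ah'))//.
      by apply: ler_piMr; [exact: ltW|have /andP[] := g01 h'].
    rewrite ler_pM2l// {2}/v mulrA mulfK ?gt_eqF//.
    by apply: ler_piMr.
  - rewrite mul0r add0r OC.
    apply: (@le_trans _ _ (w h * w h' * (5 * C2 * (s h' * s h)))).
      by rewrite ler_wpM2l ?mulr_ge0//; exact: crossO.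
    by rewrite /v -!ws// le_eqVlt; apply/orP; left; apply/eqP; ring.
  - rewrite mul0r add0r.
    apply: (@le_trans _ _ (w h * w h' * (5 * C2 * (s h * s h')))).
      by rewrite ler_wpM2l ?mulr_ge0//; exact: crossO.
    by rewrite /v -!ws// le_eqVlt; apply/orP; left; apply/eqP; ring.
pose U H := \bigcup_(h in [set h | (H <= h)%N /\ act h]) \bigcup_(n in [set n | n \in block h])
   \bigcup_(a in [set a | (1 <= a < n.+1)%N /\ coprime a n]) ball (a%:R / n%:R : R) (d h n).
have mU H : meas (U H).
  by apply: bigcup_measurable => h _; apply: bigcup_measurable => n _;
    apply: bigcup_measurable => a _; exact: measurable_ball.
(* M >= 1/2 turns the diagonal total (2 + C1) M into at most 2 (2 + C1) M^2; the cross terms give 5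
   C2 M^2. *)
pose C3 := 2 * (2 + C1) + 5 * C2.
have C30 : 0 < C3 by rewrite /C3; lra.
have hU H : ((4 / C3)%:E <= mu (U H))%E.
  have [N HN hM] := abel_dini_tail H g0 unbg.
  set M := \sum_(_ <= _ < _) _ in hM.
  pose hs := [seq h <- index_iota H N | act h].
  have hsM (F : nat -> R) : (forall h, ~~ act h -> F h = 0) ->
      \sum_(h <- hs) F h = \sum_(H <= h < N) F h.
    move=> F0; rewrite big_filter big_mkcond/=; apply: eq_bigr => h _.
    by case: ifPn => // /F0.
  have vM : \sum_(h <- hs) v h = M.
    by rewrite hsM// => h nh; rewrite /v /g (negbTE nh) mulr0.
  have act_hs h : h \in hs -> act h by rewrite mem_filter => /andP[].
  apply: (@second_moment_set (U H) hs w d s C3 M) => //.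
  - lra.
  - by rewrite -vM big_seq [RHS]big_seq; apply: eq_bigr => h /act_hs; exact: ws.
  - apply: (@le_trans _ _ (\sum_(h <- hs) \sum_(h' <- hs)
       ((h' == h)%:R * ((2 + C1) * v h) + 5 * C2 * (v h * v h')))).
      rewrite big_seq [leRHS]big_seq; apply: ler_sum => h /act_hs ah.
      by rewrite big_seq [leRHS]big_seq; apply: ler_sum => h' /act_hs; exact: wO.
    have -> : \sum_(h <- hs) \sum_(h' <- hs)
       ((h' == h)%:R * ((2 + C1) * v h) + 5 * C2 * (v h * v h')) =
       \sum_(h <- hs) (\sum_(h' <- hs) (h' == h)%:R) * ((2 + C1) * v h) + 5 * C2 * (M * M).
      under eq_bigr do rewrite big_split/= -mulr_suml.
      rewrite big_split/=; congr (_ + _).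
      rewrite -{1}vM mulr_suml mulr_sumr; apply: eq_bigr => h _.
      by rewrite -vM !mulr_sumr.
    apply: (@le_trans _ _ ((2 + C1) * M + 5 * C2 * (M * M))).
      rewrite lerD2r -vM mulr_sumr; apply: ler_sum => h _.
      apply: ler_piMl; first by apply: mulr_ge0 => //; lra.
      rewrite big_filter big_mkcond/= (@le_trans _ _ (\sum_(H <= i < N) (i == h)%:R))//.
        by apply: ler_sum => i _; case: ifP.
      by rewrite sum_nat_eq lern1 leq_b1.
    have : 0 <= (2 + C1) * M * (2 * M - 1) by rewrite !mulr_ge0//; lra.
    rewrite /C3; nra.
  - move=> h n a hh nb ha ca x bx; exists h.
      split; last exact: act_hs.
      by move: hh; rewrite mem_filter mem_index_iota => /and3P[].
    by exists n => //; exists a.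
pose B h n := act h /\ n \in block h.
have Bgt0 h n : B h n -> (0 < n)%N by move=> [_]; exact: block_gt0.
have U_hits : \bigcap_H U H `<=` all_hits B d xpredT.
  move=> x hx; exists 0%N => // H.
  have [h [Hh ah] [n nb [a [ha ca] hb]]] := hx H I.
  exists h => //; exists n; split=> //; exists (a : int); first by rewrite coprimezE.
  by rewrite expr0 mul1r distrC.
(* Finite measure is required for continuity from above along [U]. The balls have centres in [0, 1]
   and, as psi n < n, radii at most 1. *)
have U0fin : (mu (U 0%N) < +oo)%E.
  apply: (@le_lt_trans _ _ (mu (ball (0 : R) 3))).
    apply: le_mu => //; first exact: measurable_ball.
    move=> x [h [_ ah] [n nb [a [/andP[a1 an] ca] hb]]]; have n0 := block_gt0 nb.
    have n0' : 0 < n%:R :> R by rewrite ltr0n.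
    move: hb; rewrite /ball/= sub0r normrN => hb.
    have dn : d h n <= 1.
      apply: (le_trans (d_le _ _ ah nb)).
      rewrite -[leRHS]mulr1 ler_pM ?divr_ge0 ?psi_ge0 ?(ltW (e0 _))//.
      by rewrite ler_pdivrMr// mul1r ltW// (psi_lt h).
    have ar : a%:R / n%:R <= 1 :> R by rewrite ler_pdivrMr// mul1r ler_nat.
    have ar0 : 0 <= a%:R / n%:R :> R by rewrite divr_ge0.
    by move: hb; rewrite !ltr_norml; lra.
  by rewrite lebesgue_measure_ball// ltry.
have mcap : meas (\bigcap_H U H) by exact: bigcapT_measurable.
have cap_pos : ((4 / C3)%:E <= mu (\bigcap_H U H))%E.
  have hcvg : (mu \o U) x @[x --> \oo] --> mu (\bigcap_H U H).
    apply: nonincreasing_cvg_mu => //.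
    move=> H1 H2 HH; apply/subsetPset => x [h [Hh ah] hx].
    by exists h => //; split=> //; exact: leq_trans Hh.
  by apply: (cvge_ge _ hcvg); apply: nearW => H; exact: hU.
have hits_pos : mu (all_hits B d xpredT) <> 0%E.
  have : ((4 / C3)%:E <= mu (all_hits B d xpredT))%E.
    by apply: (le_trans cap_pos); apply: le_mu => //; exact: measurable_all_hits.
  move=> hh h00; move: hh; rewrite h00 lee_fin leNgt divr_gt0//.
have h1 := all_hits_zero_one Bgt0 hits_pos.
apply/eqP; rewrite eq_le measure_ge0 andbT -h1.
apply: le_mu.
- by apply: measurableC; exact: measurable_limsup_lift.
- by apply: measurableC; exact: measurable_all_hits.
apply: subsetC => x [j _ hx] M.
have [H1 hH1] := abel_dini_small g0 unbg (p0 j).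
have [h Hh [n [[ah nb] _ [a ca hax]]]] := hx (maxn H1 M).
have n0 := block_gt0 nb.
exists n; first by apply: leq_trans (block_ge _ _ nb); apply: leq_trans Hh; exact: leq_maxr.
split=> //; exists a => //; apply: (lt_le_trans hax).
apply: (@le_trans _ _ (2 ^+ j * (2 ^- j * (psi n / n%:R)))); last first.
  by rewrite mulrA mulfV ?mul1r// gt_eqF// exprn_gt0.
rewrite ler_pM2l ?exprn_gt0// (le_trans (d_le _ _ ah nb))// ler_wpM2r ?divr_ge0 ?psi_ge0//.
by apply: hH1; apply: leq_trans Hh; exact: leq_maxl.
Qed.

End Main.

Theorem theorem1p17 (R : realType) (psi : nat -> R)
  (psi_ge0 : forall n : nat, (0 < n)%N -> 0 <= psi n)
  (div : (\sum_(1 <= h <oo | (3 <= block_sum psi h)%R)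
            (ln (block_sum psi h) /
               (h%:R * ln (ln (block_sum psi h))))%R%:E)%E = +oo%E) :
  circle_measure (limsup_approx psi) = 1%E.
Proof.
apply: circle_measure_limsup.
have [hinf|hfin] := pselect (forall H, exists2 n, (H <= n)%N & n%:R <= psi n).
  exact: limsup_lift_full.
have [h0 hh0] : exists h0, forall n, (h0 <= n)%N -> psi n < n%:R.
  apply: contrapT => /forallNP hn; apply: hfin => H.
  have /existsNP[n /not_implyP[Hn /negP]] := hn H.
  by rewrite -leNgt => pn; exists n.
apply: (limsup_conull psi_ge0 hh0).
apply: (@unbounded_sums_nneseries R (gain psi) (fun h => 3 <= block_sum psi h)) => //.
by move=> h S3; exact: gain_ge0.
Qed.
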